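(* Let $\kappa>0$ be a constant. Consider the heat equation in cylindrical form, where $u(r,t)$ represents temperature in a cylinder with radius $2\pi(n+1)$, for integers $n\ge1$, $$\kappa\left(\frac{\partial^2 u}{\partial r^2}+\frac{1}{r}\frac{\partial u}{\partial r}\right)=\frac{\partial u}{\partial t},$$ with the boundary conditions: (i) $u(0,t)=\sqrt{\frac{\pi}{t}}\,u\left(0,\frac{\pi^2}{t}\right)+\frac{1}{2}\sqrt{\frac{\pi}{t}}-\frac{1}{2}$ for $t>0$; (ii) $u(r,0)=-\frac{1}{2}+\frac{1}{r}+2\sum_{m=1}^{n}\frac{1}{\sqrt{r^2-4m^2\pi^2}}$ for $2n\pi<r<2(n+1)\pi$. The solution of this problem is given by $$u(r,t)=\sum_{k=1}^{\infty}J_0(kr)e^{-k^2\kappa t}.$$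
   Context: $J_0(z)=\sum_{j=0}^\infty \frac{(-1)^j}{(j!)^2}\left(\frac z2\right)^{2j}$ is the Bessel function of the first kind of order $0$. At $t=0$ the series for $u$ converges only conditionally.
   Formalization: Condition (i) as printed fails for the given u unless κ=1 (compare both sides as t→0+); it is replaced by u(0,t)=√(π/(κt)) u(0,π²/(κ²t)) + ½√(π/(κt)) − ½, which is the printed one for κ=1. ''The solution'' is read as ''u solves the problem''; uniqueness is not claimed. *)

(* Defs.v *)
From Stdlib Require Import Reals Factorial.
From Coquelicot Require Import Coquelicot.

Open Scope R_scope.

Definition J0 (z : R) : R :=
  Series (fun j : nat => (-1) ^ j / (INR (fact j)) ^ 2 * (z / 2) ^ (2 * j)).

(* Summand of index k = j + 1, so that the series over j starts at k = 1. *)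
Definition heat_term (kappa r t : R) (j : nat) : R :=
  J0 (INR (S j) * r) * exp (- (INR (S j)) ^ 2 * kappa * t).

(* [Series] is the limit of the partial sums, hence also covers conditionally
   convergent series; it is a junk value where the series diverges. *)
Definition bessel_heat (kappa r t : R) : R := Series (heat_term kappa r t).

Definition radius (n : nat) : R := 2 * PI * (INR n + 1).

(* The differentiability conjuncts make [Derive_n _ 2] and [Derive] below genuine. *)
Definition heat_equation (kappa : R) (n : nat) (u : R -> R -> R) : Prop :=
  forall r t : R, 0 < r < radius n -> 0 < t ->
    (ex_derive (fun x => u x t) r /\ ex_derive_n (fun x => u x t) 2 r) /\
    ex_derive (fun s => u r s) t /\
    kappa * (Derive_n (fun x => u x t) 2 r + 1 / r * Derive (fun x => u x t) r)
    = Derive (fun s => u r s) t.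

(* With tau = kappa * t and U(tau) = u(0, tau / kappa) this reads
     U(tau) = sqrt(pi/tau) U(pi^2/tau) + (1/2) sqrt(pi/tau) - 1/2.
   The time variable of this self-reciprocal relation has to be tau: the
   relation with tau replaced by t is the case kappa = 1, and fails for
   [bessel_heat kappa] when kappa <> 1. *)
Definition axis_condition (kappa : R) (u : R -> R -> R) : Prop :=
  forall t : R, 0 < t ->
    u 0 t = sqrt (PI / (kappa * t)) * u 0 (PI ^ 2 / (kappa ^ 2 * t))
            + 1 / 2 * sqrt (PI / (kappa * t)) - 1 / 2.

Definition annulus (n : nat) (r : R) : Prop :=
  2 * INR n * PI < r < 2 * (INR n + 1) * PI.

Definition initial_condition (n : nat) (u : R -> R -> R) : Prop :=
  forall r : R, annulus n r ->
    u r 0 = - (1 / 2) + 1 / r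
            + 2 * sum_n_m (fun m : nat =>
                    1 / sqrt (r ^ 2 - 4 * (INR m) ^ 2 * PI ^ 2)) 1 n.

(* Ties the values on the axis and at time 0 to those in the region where the
   equation holds. *)
Definition attains_boundary_values (n : nat) (u : R -> R -> R) : Prop :=
  (forall t : R, 0 < t ->
     filterlim (fun r => u r t) (at_right 0) (locally (u 0 t))) /\
  (forall r : R, annulus n r ->
     filterlim (fun t => u r t) (at_right 0) (locally (u r 0))).

Definition solves_heat_problem (kappa : R) (n : nat) (u : R -> R -> R) : Prop :=
  heat_equation kappa n u /\ axis_condition kappa u /\
  initial_condition n u /\ attains_boundary_values n u.

(* Main.v *)
Require Import Defs.
From Stdlib Require Import Reals Factorial Lra Lia Classical_Prop.
From Coquelicot Require Import Coquelicot.

(** Poisson summation drives both boundary conditions.  For [g] of class C^2 on [0, X] with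
    [2 pi n < X < 2 pi (n + 1)], two integrations by parts and the closed form of
    [sum_k cos (k x) / k^2] give
      [sum_k int_0^X g(x) cos (k x) dx = pi (g(0)/2 + sum_{m=1}^n g(2 pi m)) - (1/2) int_0^X g].
    With [J0(z) = (2/pi) int_0^{pi/2} cos (z sin th) dth] and [x = r sin th], this sums
    [J0(k r)] through [g(x) = 1 / sqrt(r^2 - x^2)]; a neighbourhood of the singularity [x = r]
    contributes little, uniformly in the number of terms, because the Dirichlet kernel is bounded
    there.  Abel summation then gives the limit as [t] tends to 0.  With a Gaussian [g] and [X]
    tending to infinity it gives the theta functional equation up to a constant, which the
    self-dual point determines, so that the Gaussian integral need not be computed.  The heat
    equation holds termwise by the Bessel equation, with derivatives dominated by
    [k^2 exp (- k^2 kappa t)]. *)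

Open Scope R_scope.

(** * Series depending on a parameter *)

(* Coquelicot's sums live in a structure convertible to [R], which [ring] does not see through. *)
Ltac Rring := apply Rminus_diag_uniq; ring.
Ltac Rfield := apply Rminus_diag_uniq; field.

(** Since [1 / sqrt (r^2 - x^2)] is not of class C^2 at [x = r], it is applied on [[0, r sin th]]
    with [th < PI / 2]. The cut [th] must be fixed before the number of terms, which is why the
    bound on the remaining piece is linear in [PI / 2 - th] and uniform in [N]. Membership in the
    annulus keeps [sin (x / 2)] away from 0 near [x = r]. The constant in the closed form of the
    cosine series (classically [PI^2 / 6]) stays existential: it multiplies [g1 X - g1 0] in the
    boundary terms and again in the integral against [g2], with opposite signs. For the Gaussian,
    exchanging the sum over [k] with the limit of [X] calls for a summable majorant in [k] that is
    uniform in [X]. The boundary term [g X * sin (k X) / k] is too large for that, so [X] runs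
    through odd multiples of [PI], where it vanishes. *)

Lemma sum_n_RS (a : nat -> R) (N : nat) : sum_n a (S N) = sum_n a N + a (S N).
Proof. exact (sum_Sn a N). Qed.

Lemma Series_split (a : nat -> R) (N : nat) :
  ex_series a -> Series a = sum_n a N + Series (fun k => a (S N + k)%nat).
Proof.
  intros H; rewrite (Series_incr_n a (S N)); [|lia|exact H].
  now rewrite sum_n_Reals.
Qed.

Lemma is_series_eps (a : nat -> R) (l : R) :
  is_series a l <->
  forall eps, 0 < eps -> exists N, forall n, (N <= n)%nat -> Rabs (sum_n a n - l) < eps.
Proof.
  split.
  - intros H eps He.
    destruct (proj1 (filterlim_locally _ _) H (mkposreal eps He)) as [N HN].
    exists N; intros n Hn; exact (HN n Hn).
  - intros H; apply (proj2 (filterlim_locally _ _)); intros eps.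
    destruct (H eps (cond_pos eps)) as [N HN].
    exists N; intros n Hn; exact (HN n Hn).
Qed.

Lemma ex_series_dom (f M : nat -> R) :
  (forall k, Rabs (f k) <= M k) -> ex_series M -> ex_series f.
Proof. intros H HM; exact (ex_series_le f M H HM). Qed.

Lemma Rabs_Series_le (f M : nat -> R) :
  (forall k, Rabs (f k) <= M k) -> ex_series M -> Rabs (Series f) <= Series M.
Proof.
  intros H HM.
  assert (HA : ex_series (fun k => Rabs (f k))).
  { apply ex_series_dom with M; [|exact HM]; intros k; rewrite Rabs_Rabsolu; apply H. }
  apply Rle_trans with (1 := Series_Rabs f HA).
  apply Series_le; [|exact HM].
  intros k; split; [apply Rabs_pos | apply H].
Qed.

Lemma Series_remainder_le (f M : nat -> R) (N : nat) :
  (forall k, Rabs (f k) <= M k) -> ex_series M ->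
  Rabs (Series f - sum_n f N) <= Series M - sum_n M N.
Proof.
  intros H HM.
  rewrite (Series_split f N), (Series_split M N) by
    (try exact HM; now apply ex_series_dom with M).
  replace (sum_n f N + Series (fun k => f (S N + k)%nat) - sum_n f N)
    with (Series (fun k => f (S N + k)%nat)) by ring.
  replace (sum_n M N + Series (fun k => M (S N + k)%nat) - sum_n M N)
    with (Series (fun k => M (S N + k)%nat)) by ring.
  apply Rabs_Series_le; [intros k; apply H|].
  now apply (ex_series_incr_n M (S N)).
Qed.

Lemma filterlim_eps {T : Type} (F : (T -> Prop) -> Prop) {FF : Filter F} (f : T -> R) (l : R) :
  filterlim f F (locally l) <->
  forall eps, 0 < eps -> F (fun x => Rabs (f x - l) < eps).
Proof.
  split.
  - intros H eps He; exact (proj1 (filterlim_locally _ _) H (mkposreal eps He)).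
  - intros H; apply (proj2 (filterlim_locally _ _)); intros eps; exact (H eps (cond_pos eps)).
Qed.

Lemma filterlim_sum_n {T : Type} (F : (T -> Prop) -> Prop) {FF : Filter F}
  (f : nat -> T -> R) (c : nat -> R) (N : nat) :
  (forall k, filterlim (f k) F (locally (c k))) ->
  filterlim (fun y => sum_n (fun k => f k y) N) F (locally (sum_n c N)).
Proof.
  intros H; induction N as [|N IH].
  - rewrite sum_O; apply filterlim_ext with (f 0%nat); [|apply H].
    intros y; now rewrite sum_O.
  - rewrite sum_n_RS.
    apply filterlim_ext with (fun y => sum_n (fun k => f k y) N + f (S N) y).
    { intros y; now rewrite sum_n_RS. }
    apply (filterlim_comp_2 (G := locally (sum_n c N)) (H := locally (c (S N)))
      _ _ Rplus IH (H (S N))).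
    exact (filterlim_plus (sum_n c N) (c (S N))).
Qed.

(** Dominated convergence for series. The limits [c k] inherit the majorant, so beyond a common
    index both tails are below [eps / 3], and only a finite sum has to converge. A general proper
    filter lets it serve for continuity in a parameter, for difference quotients and for sequences
    of intervals. *)
Lemma tannery {T : Type} (F : (T -> Prop) -> Prop) {FF : ProperFilter F}
  (f : nat -> T -> R) (c M : nat -> R) :
  ex_series M -> F (fun y => forall k, Rabs (f k y) <= M k) ->
  (forall k, filterlim (f k) F (locally (c k))) ->
  filterlim (fun y => Series (fun k => f k y)) F (locally (Series c)).
Proof.
  intros HM Hdom Hlim.
  assert (Hc : forall k, Rabs (c k) <= M k).
  { intros k.
    apply (filterlim_le (F := F) (fun y => Rabs (f k y)) (fun _ => M k)
      (Finite (Rabs (c k))) (Finite (M k))).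
    - revert Hdom; apply filter_imp; intros y Hy; apply Hy.
    - apply (filterlim_comp _ _ _ _ _ _ _ _ (Hlim k)).
      apply (filterlim_Rabs (Finite (c k))).
    - apply filterlim_const. }
  apply filterlim_eps; [typeclasses eauto|]; intros eps He.
  destruct (proj1 (is_series_eps M _) (Series_correct _ HM) (eps / 3)) as [N HN]; [lra|].
  specialize (HN N (le_n _)).
  assert (Htail : Series M - sum_n M N < eps / 3).
  { apply Rabs_def2 in HN; lra. }
  assert (Hfin := proj1 (filterlim_eps F _ _) (filterlim_sum_n F f c N Hlim) (eps / 3)).
  assert (He3 : 0 < eps / 3) by lra.
  generalize (filter_and _ _ Hdom (Hfin He3)); apply filter_imp; intros y [H1 H2].
  assert (A1 := Series_remainder_le (fun k => f k y) M N H1 HM).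
  assert (A2 := Series_remainder_le c M N Hc HM).
  apply Rabs_def2 in H2.
  apply Rabs_le_between in A1. apply Rabs_le_between in A2.
  apply Rabs_def1; lra.
Qed.

Lemma continuous_Series (f : nat -> R -> R) (M : nat -> R) (x : R) :
  ex_series M -> locally x (fun y => forall k, Rabs (f k y) <= M k) ->
  (forall k, continuous (f k) x) ->
  continuous (fun y => Series (fun k => f k y)) x.
Proof. intros HM Hd Hc; exact (tannery (locally x) f (fun k => f k x) M HM Hd Hc). Qed.

Lemma MVT_bound (f df : R -> R) (K a b : R) :
  (forall x, Rmin a b <= x <= Rmax a b -> is_derive f x (df x)) ->
  (forall x, Rmin a b <= x <= Rmax a b -> Rabs (df x) <= K) ->
  Rabs (f b - f a) <= K * Rabs (b - a).
Proof.
  intros Hd HK.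
  destruct (MVT_gen f a b df) as [c [Hc ->]].
  - intros x Hx; apply Hd; lra.
  - intros x Hx; apply continuity_pt_filterlim.
    apply (ex_derive_continuous f x); eexists; apply Hd, Hx.
  - rewrite Rabs_mult; apply Rmult_le_compat_r; [apply Rabs_pos | now apply HK].
Qed.

Lemma is_derive_quotient (f : R -> R) (x l : R) :
  is_derive f x l <->
  filterlim (fun h => (f (x + h) - f x) / h) (locally' 0) (locally l).
Proof.
  rewrite is_derive_Reals; split.
  - intros H; apply filterlim_eps; [typeclasses eauto|]; intros eps He.
    destruct (H eps He) as [d Hd].
    exists d; intros h Hh Hh0; apply Hd; [exact Hh0|].
    replace h with (h - 0) by ring; exact Hh.
  - intros H eps He.
    destruct (proj1 (filterlim_eps _ _ _) H eps He) as [d Hd].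
    exists d; intros h Hh0 Hh; apply Hd; [|exact Hh0].
    change (Rabs (h - 0) < d); now rewrite Rminus_0_r.
Qed.

(** Tannery's theorem on the punctured neighbourhood filter, applied to difference quotients; the
    mean value inequality bounds the k-th quotient by [M k]. *)
Lemma is_derive_Series (f df : nat -> R -> R) (M : nat -> R) (x : R) (d : posreal) :
  ex_series M ->
  (forall y, Rabs (y - x) < d -> ex_series (fun k => f k y)) ->
  (forall k y, Rabs (y - x) < d -> is_derive (f k) y (df k y)) ->
  (forall k y, Rabs (y - x) < d -> Rabs (df k y) <= M k) ->
  is_derive (fun y => Series (fun k => f k y)) x (Series (fun k => df k x)).
Proof.
  intros HM Hex Hd Hb; apply is_derive_quotient.
  assert (Hx0 : Rabs (x - x) < d).
  { rewrite Rminus_diag, Rabs_R0; apply cond_pos. }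
  apply filterlim_ext_loc with (fun h => Series (fun k => (f k (x + h) - f k x) / h)).
  { exists d; intros h Hh Hh0.
    change (Rabs (h - 0) < d) in Hh; rewrite Rminus_0_r in Hh.
    unfold Rdiv; rewrite Series_scal_r, Series_minus; [reflexivity| |now apply Hex].
    apply Hex; now rewrite Rplus_minus_l. }
  apply (tannery (FF := Rbar_locally'_filter (Finite 0)) (locally' 0) (fun k h => (f k (x + h) - f k x) / h)
    (fun k => df k x) M HM).
  - exists d; intros h Hh Hh0 k.
    change (Rabs (h - 0) < d) in Hh; rewrite Rminus_0_r in Hh.
    unfold Rdiv; rewrite Rabs_mult, Rabs_inv.
    apply Rmult_le_reg_r with (Rabs h); [now apply Rabs_pos_lt|].
    rewrite Rmult_assoc, Rinv_l, Rmult_1_r by now apply Rabs_no_R0.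
    assert (Hin : forall y, Rmin x (x + h) <= y <= Rmax x (x + h) -> Rabs (y - x) < d).
    { intros y Hy; apply Rle_lt_trans with (2 := Hh).
      revert Hy; unfold Rmin, Rmax; destruct (Rle_dec x (x + h)); intros Hy;
      unfold Rabs; destruct (Rcase_abs (y - x)), (Rcase_abs h); lra. }
    assert (E := MVT_bound (f k) (df k) (M k) x (x + h)).
    rewrite Rplus_minus_l in E; apply E; intros y Hy; [apply Hd | apply Hb]; now apply Hin.
  - intros k; apply is_derive_quotient, Hd, Hx0.
Qed.

(** Abel's inequality, by summation by parts. *)
Lemma abel_sum_bound (a b : nat -> R) (e : R) (N : nat) :
  (forall n, Rabs (sum_n a n) <= e) ->
  (forall k, b (S k) <= b k) -> (forall k, 0 <= b k) ->
  Rabs (sum_n (fun k => a k * b k) N) <= e * b 0%nat.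
Proof.
  intros Ha Hb Hb0.
  (* Removing the boundary term [sum_n a N * b N] gives a quantity whose increments are
     [sum_n a N * (b N - b (S N))], so the bound telescopes. *)
  assert (H : Rabs (sum_n (fun k => a k * b k) N - sum_n a N * b N) <= e * (b 0%nat - b N)).
  { induction N as [|N IH].
    - rewrite !sum_O, !Rminus_diag, Rabs_R0; lra.
    - rewrite !sum_n_RS.
      replace (sum_n (fun k => a k * b k) N + a (S N) * b (S N)
               - (sum_n a N + a (S N)) * b (S N))
        with ((sum_n (fun k => a k * b k) N - sum_n a N * b N)
              + sum_n a N * (b N - b (S N))) by ring.
      apply Rle_trans with (1 := Rabs_triang _ _).
      rewrite Rabs_mult, (Rabs_pos_eq (b N - b (S N))) by (specialize (Hb N); lra).
      assert (Rabs (sum_n a N) * (b N - b (S N)) <= e * (b N - b (S N))).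
      { apply Rmult_le_compat_r; [specialize (Hb N); lra | apply Ha]. }
      lra. }
  assert (H2 : Rabs (sum_n a N * b N) <= e * b N).
  { rewrite Rabs_mult, (Rabs_pos_eq (b N)) by apply Hb0.
    apply Rmult_le_compat_r; [apply Hb0 | apply Ha]. }
  replace (sum_n (fun k => a k * b k) N) with
    ((sum_n (fun k => a k * b k) N - sum_n a N * b N) + sum_n a N * b N) by ring.
  apply Rle_trans with (1 := Rabs_triang _ _); lra.
Qed.

Lemma sum_n_shift (a : nat -> R) (N n : nat) :
  sum_n (fun k => a (S N + k)%nat) n = sum_n a (S N + n)%nat - sum_n a N.
Proof.
  induction n as [|n IH].
  - rewrite sum_O, !Nat.add_0_r, sum_n_RS; Rring.
  - rewrite sum_n_RS, IH, <- !plus_n_Sm, sum_n_RS; Rring.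
Qed.

Lemma Rabs_Series_le_of_partial (a : nat -> R) (e : R) :
  ex_series a -> (forall n, Rabs (sum_n a n) <= e) -> Rabs (Series a) <= e.
Proof.
  intros Ha H; apply Rnot_lt_le; intros Hlt.
  destruct (proj1 (is_series_eps a _) (Series_correct _ Ha) (Rabs (Series a) - e))
    as [N HN]; [lra|].
  specialize (HN N (le_n _)); specialize (H N).
  assert (T := Rabs_triang_inv (Series a) (sum_n a N)).
  rewrite Rabs_minus_sym in HN; lra.
Qed.

(** Replaces [tannery] when [a] is only conditionally summable: since the factors decrease in [k]
    and stay in [[0, 1]], Abel's inequality bounds the tail uniformly in the parameter. *)
Lemma abel_limit {T : Type} (F : (T -> Prop) -> Prop) {FF : ProperFilter F}
  (a : nat -> R) (b : nat -> T -> R) :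
  ex_series a ->
  F (fun t => (forall k, b (S k) t <= b k t) /\ (forall k, 0 <= b k t <= 1) /\
              ex_series (fun k => a k * b k t)) ->
  (forall k, filterlim (b k) F (locally 1)) ->
  filterlim (fun t => Series (fun k => a k * b k t)) F (locally (Series a)).
Proof.
  intros Ha Hb Hlim.
  apply filterlim_eps; [typeclasses eauto|]; intros eps He.
  (* A block of consecutive terms is a difference of two partial sums, each within [eps / 6] of the
     sum; this makes every block after [N] at most [eps / 3]. *)
  destruct (proj1 (is_series_eps a _) (Series_correct _ Ha) (eps / 6)) as [N HN]; [lra|].
  assert (Hfin : filterlim (fun y => sum_n (fun k => a k * b k y) N) F (locally (sum_n a N))).
  { apply (filterlim_sum_n F (fun k t => a k * b k t) a N); intros k.
    replace (locally (a k)) with (locally (a k * 1)) by now rewrite Rmult_1_r.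
    apply (filterlim_comp _ _ _ _ (fun y => a k * y) _ _ _ (Hlim k)).
    apply (ex_derive_continuous (fun y => a k * y) 1); auto_derive; trivial. }
  assert (He3 : 0 < eps / 3) by lra.
  assert (HF := proj1 (filterlim_eps F _ _) Hfin (eps / 3) He3).
  generalize (filter_and _ _ Hb HF); apply filter_imp; intros t [[H1 [H2 H3]] H4].
  rewrite (Series_split _ N H3).
  assert (HT : Rabs (Series (fun k => a (S N + k)%nat * b (S N + k)%nat t)) <= eps / 3).
  { apply Rabs_Series_le_of_partial.
    - exact (proj1 (ex_series_incr_n (fun k => a k * b k t) (S N)) H3).
    - intros n.
      apply Rle_trans with (eps / 3 * b (S N + 0)%nat t).
      + apply (abel_sum_bound (fun k => a (S N + k)%nat) (fun k => b (S N + k)%nat t)).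
        * intros m; rewrite sum_n_shift.
          assert (U := HN (S N + m)%nat ltac:(lia)); assert (V := HN N (le_n _)).
          apply Rabs_def2 in U; apply Rabs_def2 in V; apply Rabs_le; lra.
        * intros k; rewrite <- plus_n_Sm; apply H1.
        * intros k; apply H2.
      + specialize (H2 (S N + 0)%nat); nra. }
  assert (V := HN N (le_n _)).
  apply Rabs_def2 in V; apply Rabs_def2 in H4; apply Rabs_le_between in HT.
  apply Rabs_def1; lra.
Qed.

Lemma RInt_sum_n (f : nat -> R -> R) (a b : R) (N : nat) :
  (forall k, ex_RInt (f k) a b) ->
  ex_RInt (fun x => sum_n (fun k => f k x) N) a b /\
  RInt (fun x => sum_n (fun k => f k x) N) a b = sum_n (fun k => RInt (f k) a b) N.
Proof.
  intros H; induction N as [|N [IH1 IH2]].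
  - split.
    + apply ex_RInt_ext with (f 0%nat); [intros; now rewrite sum_O|apply H].
    + rewrite sum_O; apply RInt_ext; intros; now rewrite sum_O.
  - split.
    + apply ex_RInt_ext with (fun x => plus (sum_n (fun k => f k x) N) (f (S N) x)).
      * intros; now rewrite sum_n_RS.
      * apply @ex_RInt_plus; [exact IH1 | apply H].
    + rewrite sum_n_RS.
      transitivity (plus (RInt (fun x => sum_n (fun k => f k x) N) a b) (RInt (f (S N)) a b)).
      * rewrite <- (RInt_plus _ _ _ _ IH1 (H (S N))).
        apply RInt_ext; intros; now rewrite sum_n_RS.
      * exact (f_equal (fun z => z + RInt (f (S N)) a b) IH2).
Qed.

Lemma is_series_RInt (f : nat -> R -> R) (F : R -> R) (M : nat -> R) (a b : R) :
  a <= b -> ex_series M ->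
  (forall k, ex_RInt (f k) a b) -> ex_RInt F a b ->
  (forall k x, a <= x <= b -> Rabs (f k x) <= M k) ->
  (forall x, a <= x <= b -> is_series (fun k => f k x) (F x)) ->
  is_series (fun k => RInt (f k) a b) (RInt F a b).
Proof.
  intros Hab HM Hf HF Hb Hs; apply is_series_eps; intros eps He.
  (* The [+ 1] keeps the quotient meaningful when [a = b]. *)
  destruct (proj1 (is_series_eps M _) (Series_correct _ HM) (eps / (b - a + 1))) as [N HN].
  { apply Rdiv_lt_0_compat; lra. }
  exists N; intros n Hn; specialize (HN n Hn).
  destruct (RInt_sum_n f a b n Hf) as [E1 E2].
  cut (Rabs (RInt (fun x => sum_n (fun k => f k x) n) a b - RInt F a b) < eps).
  { intros H; refine (Rle_lt_trans _ _ _ (Req_le _ _ _) H).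
    exact (f_equal (fun z => Rabs (z - RInt F a b)) (eq_sym E2)). }
  assert (E4 : RInt (fun x => sum_n (fun k => f k x) n - F x) a b
    = RInt (fun x => sum_n (fun k => f k x) n) a b - RInt F a b)
    by exact (RInt_minus _ _ _ _ E1 HF).
  assert (E3 : Rabs (RInt (fun x => sum_n (fun k => f k x) n - F x) a b)
    <= (b - a) * (eps / (b - a + 1))).
  { apply abs_RInt_le_const; [exact Hab | exact (ex_RInt_minus _ _ _ _ E1 HF)|].
    intros x Hx; rewrite <- (is_series_unique _ _ (Hs x Hx)).
    change (Rabs (sum_n (fun k => f k x) n - Series (fun k => f k x)) <= eps / (b - a + 1)).
    rewrite Rabs_minus_sym.
    apply Rle_trans with (1 := Series_remainder_le _ M n (fun k => Hb k x Hx) HM).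
    apply Rabs_def2 in HN; lra. }
  rewrite E4 in E3.
  apply Rle_lt_trans with (1 := E3).
  apply Rmult_lt_reg_r with (b - a + 1); [lra|].
  field_simplify; [|lra]. nra.
Qed.

(** * Trigonometric series *)

(** Multiplication by [2 sin (x / 2)] turns each cosine into a difference of sines at consecutive
    half-integer frequencies, so the sum telescopes. Frequencies start at 1, which leaves
    [- sin (x / 2)]. *)
Lemma dirichlet_kernel (x : R) (N : nat) :
  2 * sin (x / 2) * sum_n (fun k => cos (INR (S k) * x)) N
  = sin ((INR N + 3 / 2) * x) - sin (x / 2).
Proof.
  assert (E : forall k : nat, 2 * sin (x / 2) * cos (INR (S k) * x)
    = sin ((INR k + 3 / 2) * x) - sin ((INR k + 1 / 2) * x)).
  { intros k; rewrite S_INR.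
    replace ((INR k + 3 / 2) * x) with ((INR k + 1) * x + x / 2) by field.
    replace ((INR k + 1 / 2) * x) with ((INR k + 1) * x - x / 2) by field.
    rewrite sin_plus, sin_minus; ring. }
  induction N as [|N IH].
  - rewrite sum_O, E; simpl INR; do 2 f_equal; field.
  - rewrite sum_n_RS, Rmult_plus_distr_l, IH, E, S_INR.
    replace ((INR N + 1 + 1 / 2) * x) with ((INR N + 3 / 2) * x) by field; ring.
Qed.

Lemma dirichlet_kernel_div (x : R) (N : nat) : sin (x / 2) <> 0 ->
  sum_n (fun k => cos (INR (S k) * x)) N
  = - (1 / 2) + sin ((INR N + 3 / 2) * x) / (2 * sin (x / 2)).
Proof.
  intros H; apply Rmult_eq_reg_l with (2 * sin (x / 2)); [|lra].
  rewrite dirichlet_kernel; field; exact H.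
Qed.

Lemma sin_INR_PI (k : nat) : sin (INR k * PI) = 0.
Proof. apply sin_eq_0_1; exists (Z.of_nat k); now rewrite INR_IZR_INZ. Qed.

Lemma is_derive_sum_n (f df : nat -> R -> R) (x : R) (N : nat) :
  (forall k, is_derive (f k) x (df k x)) ->
  is_derive (fun y => sum_n (fun k => f k y) N) x (sum_n (fun k => df k x) N).
Proof.
  intros H; induction N as [|N IH].
  - rewrite sum_O; apply is_derive_ext with (f 0%nat); [|apply H].
    intros; now rewrite sum_O.
  - rewrite sum_n_RS.
    apply is_derive_ext with (fun y => plus (sum_n (fun k => f k y) N) (f (S N) y)).
    + intros; now rewrite sum_n_RS.
    + apply @is_derive_plus; [exact IH | apply H].
Qed.

Lemma sum_n_Ropp (a : nat -> R) (N : nat) : sum_n (fun k => - a k) N = - sum_n a N.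
Proof.
  induction N as [|N IH]; [now rewrite !sum_O|].
  rewrite !sum_n_RS, IH; Rring.
Qed.

Lemma INR_S_pos (k : nat) : 0 < INR (S k).
Proof. apply lt_0_INR; lia. Qed.

Lemma sin_half_lower (a x : R) : 0 < a <= PI -> a <= x <= 2 * PI - a ->
  sin (a / 2) <= sin (x / 2).
Proof.
  intros Ha Hx.
  destruct (Rle_dec x PI) as [H|H].
  - apply sin_incr_1; lra.
  - replace (sin (x / 2)) with (sin (PI - x / 2)) by apply sin_PI_x.
    apply sin_incr_1; lra.
Qed.

(* The derivative of the remainder is [sin (l x) / (2 sin (x / 2))]; subtracting its main
   antiderivative [- cos (l x) / (2 l sin (x / 2))] leaves an error with derivative O(1 / l). *)
Lemma sawtooth_remainder (a : R) : 0 < a <= PI -> exists K, 0 <= K /\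
  forall x N, a <= x <= 2 * PI - a ->
  Rabs (sum_n (fun k => sin (INR (S k) * x) / INR (S k)) N - (PI - x) / 2) <= K / (INR N + 1).
Proof.
  intros Ha.
  set (d := sin (a / 2)).
  assert (Hd : 0 < d) by (apply sin_gt_0; lra).
  (* With [l = N + 3 / 2], the three parts divided by [l] bound: the derivative of [R0 - E] times a
     distance at most [PI]; [E x], as [d <= sin (x / 2)]; and [E PI], as [sin (PI / 2) = 1]. *)
  exists (PI / (4 * d ^ 2) + 1 / (2 * d) + 1 / 2).
  assert (HPI := PI_RGT_0).
  assert (Hd2 : 0 < d ^ 2) by (apply pow_lt; lra).
  assert (P1 : 0 < PI / (4 * d ^ 2)) by (apply Rdiv_lt_0_compat; lra).
  assert (P2 : 0 < 1 / (2 * d)) by (apply Rdiv_lt_0_compat; lra).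
  split; [lra|].
  intros x N Hx.
  set (l := INR N + 3 / 2).
  assert (Hl : INR N + 1 < l) by (unfold l; lra).
  assert (HN := pos_INR N).
  set (R0 := fun y => sum_n (fun k => sin (INR (S k) * y) / INR (S k)) N - (PI - y) / 2).
  set (E := fun y => - cos (l * y) / (2 * l * sin (y / 2))).
  assert (Hs : forall y, a <= y <= 2 * PI - a -> d <= sin (y / 2))
    by (intros; now apply sin_half_lower).
  assert (HD : forall y, a <= y <= 2 * PI - a ->
    is_derive (fun z => R0 z - E z) y (- (cos (l * y) * cos (y / 2)) / (4 * l * sin (y / 2) ^ 2))).
  { intros y Hy; specialize (Hs y Hy).
    assert (D1 : is_derive R0 y (sum_n (fun k => cos (INR (S k) * y)) N + 1 / 2)).
    { unfold R0.
      apply (@is_derive_plus R_AbsRing R_NormedModule).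
      - apply (is_derive_sum_n (fun k z => sin (INR (S k) * z) / INR (S k))
          (fun k z => cos (INR (S k) * z))).
        intros k; generalize (INR (S k)) (INR_S_pos k); intros c P; auto_derive; [trivial|]. field; lra.
      - auto_derive; [trivial|]; field. }
    assert (D2 : is_derive E y (sin (l * y) / (2 * sin (y / 2))
      + cos (l * y) * cos (y / 2) / (4 * l * sin (y / 2) ^ 2))).
    { unfold E; auto_derive; [apply Rmult_integral_contrapositive; split; lra|].
      change (y * / 2) with (y / 2); field; lra. }
    replace (- (cos (l * y) * cos (y / 2)) / (4 * l * sin (y / 2) ^ 2)) with
      ((sum_n (fun k => cos (INR (S k) * y)) N + 1 / 2) -
       (sin (l * y) / (2 * sin (y / 2)) + cos (l * y) * cos (y / 2) / (4 * l * sin (y / 2) ^ 2))).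
    - exact (is_derive_minus R0 E y _ _ D1 D2).
    - rewrite dirichlet_kernel_div by lra; unfold l; field; fold l; lra. }
  assert (HB : forall y, a <= y <= 2 * PI - a ->
    Rabs (- (cos (l * y) * cos (y / 2)) / (4 * l * sin (y / 2) ^ 2)) <= 1 / (4 * l * d ^ 2)).
  { intros y Hy; specialize (Hs y Hy).
    assert (Q : d ^ 2 <= sin (y / 2) ^ 2) by (apply pow_incr; lra).
    unfold Rdiv; rewrite Rabs_mult, Rabs_Ropp, Rabs_mult, Rabs_inv.
    rewrite (Rabs_pos_eq (4 * l * _)) by (apply Rmult_le_pos; lra).
    apply Rmult_le_compat.
    - apply Rmult_le_pos; apply Rabs_pos.
    - left; apply Rinv_0_lt_compat, Rmult_lt_0_compat; lra.
    - rewrite <- (Rmult_1_r 1); apply Rmult_le_compat; try apply Rabs_pos;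
        apply Rabs_le, COS_bound.
    - apply Rinv_le_contravar; [apply Rmult_lt_0_compat; lra|].
      apply Rmult_le_compat_l; lra. }
  assert (HM : Rabs ((R0 x - E x) - (R0 PI - E PI)) <= 1 / (4 * l * d ^ 2) * Rabs (x - PI)).
  { apply (MVT_bound (fun z => R0 z - E z)
      (fun y => - (cos (l * y) * cos (y / 2)) / (4 * l * sin (y / 2) ^ 2)) _ PI x); intros y Hy; [apply HD | apply HB];
    revert Hy; unfold Rmin, Rmax; destruct (Rle_dec PI x); lra. }
  (* The midpoint anchors the mean value estimate: every sine and the limit [(PI - x) / 2] vanish
     there. *)
  assert (HR : R0 PI = 0).
  { unfold R0.
    rewrite (sum_n_ext _ (fun _ => 0)) by (intros k; rewrite sin_INR_PI; unfold Rdiv; Rring).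
    rewrite sum_n_const; lra. }
  assert (HEx : forall y e, a <= y <= 2 * PI - a -> 0 < e <= sin (y / 2) ->
    Rabs (E y) <= 1 / (2 * l * e)).
  { intros y e Hy He; unfold E, Rdiv.
    rewrite Rabs_mult, Rabs_Ropp, Rabs_inv.
    rewrite (Rabs_pos_eq (2 * l * _)) by (apply Rmult_le_pos; lra).
    apply Rmult_le_compat; [apply Rabs_pos| | apply Rabs_le, COS_bound |].
    - left; apply Rinv_0_lt_compat, Rmult_lt_0_compat; lra.
    - apply Rinv_le_contravar; [apply Rmult_lt_0_compat; lra|].
      apply Rmult_le_compat_l; lra. }
  assert (H1 := HEx x d Hx (conj Hd (Hs x Hx))).
  assert (H2 : Rabs (E PI) <= 1 / (2 * l * 1)).
  { apply HEx; [lra|]; rewrite sin_PI2; lra. }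
  rewrite HR in HM.
  change (Rabs (R0 x) <= (PI / (4 * d ^ 2) + 1 / (2 * d) + 1 / 2) / (INR N + 1)).
  apply Rle_trans with ((PI / (4 * d ^ 2) + 1 / (2 * d) + 1 / 2) / l).
  - assert (HM2 : 1 / (4 * l * d ^ 2) * Rabs (x - PI) <= PI / (4 * d ^ 2) / l).
    { replace (PI / (4 * d ^ 2) / l) with (1 / (4 * l * d ^ 2) * PI) by (field; lra).
      apply Rmult_le_compat_l; [|apply Rabs_le; lra].
      left; apply Rdiv_lt_0_compat; [lra|]; apply Rmult_lt_0_compat; lra. }
    replace (R0 x) with ((R0 x - E x - (0 - E PI)) + E x - E PI) by ring.
    apply Rle_trans with (1 := Rabs_triang _ _); rewrite Rabs_Ropp.
    apply Rle_trans with (Rabs (R0 x - E x - (0 - E PI)) + Rabs (E x) + Rabs (E PI)).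
    { apply Rplus_le_compat_r, Rabs_triang. }
    replace ((PI / (4 * d ^ 2) + 1 / (2 * d) + 1 / 2) / l) with
      (PI / (4 * d ^ 2) / l + 1 / (2 * l * d) + 1 / (2 * l * 1)) by (field; lra).
    lra.
  - apply Rmult_le_compat_l; [lra|]; apply Rinv_le_contravar; lra.
Qed.

Lemma eventually_div_INR_lt (K e : R) : 0 <= K -> 0 < e ->
  exists N, forall n, (N <= n)%nat -> K / (INR n + 1) < e.
Proof.
  intros HK He.
  destruct (nfloor_ex (K / e)) as [N HN].
  { apply Rmult_le_pos; [exact HK | left; now apply Rinv_0_lt_compat]. }
  exists N; intros n Hn.
  assert (H := le_INR _ _ Hn); assert (HP := pos_INR n).
  apply Rmult_lt_reg_r with ((INR n + 1) / e).
  - apply Rdiv_lt_0_compat; lra.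
  - replace (K / (INR n + 1) * ((INR n + 1) / e)) with (K / e) by (field; lra).
    replace (e * ((INR n + 1) / e)) with (INR n + 1) by (field; lra). lra.
Qed.

Lemma is_series_sawtooth (x : R) : 0 < x < 2 * PI ->
  is_series (fun k => sin (INR (S k) * x) / INR (S k)) ((PI - x) / 2).
Proof.
  intros Hx.
  destruct (sawtooth_remainder (Rmin x (2 * PI - x))) as [K [HK H]].
  { unfold Rmin; destruct (Rle_dec x (2 * PI - x)); lra. }
  apply is_series_eps; intros eps He.
  destruct (eventually_div_INR_lt K eps HK He) as [N HN].
  exists N; intros n Hn; apply Rle_lt_trans with (2 := HN n Hn), H.
  unfold Rmin; destruct (Rle_dec x (2 * PI - x)); lra.
Qed.

Lemma ex_series_inv_sqr : ex_series (fun k => 1 / INR (S k) ^ 2).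
Proof.
  exists (Series (fun k => 1 / INR (S k) ^ 2)).
  apply Series_correct.
  (* Dropping the first term makes the comparison with a telescoping series possible: [1 / (k + 2)^2
     <= 1 / (k + 1) - 1 / (k + 2)]. *)
  apply (ex_series_incr_1 (fun k => 1 / INR (S k) ^ 2)).
  apply ex_series_dom with (fun k => / INR (S k) - / INR (S (S k))).
  - intros k; assert (H := INR_S_pos k).
    rewrite (S_INR (S k)) in *.
    rewrite Rabs_pos_eq.
    + apply Rle_trans with (1 / (INR (S k) * (INR (S k) + 1))).
      * apply Rmult_le_compat_l; [lra|]; apply Rinv_le_contravar; nra.
      * right; field; lra.
    + apply Rlt_le, Rdiv_lt_0_compat; nra.
  - exists 1; apply is_series_eps; intros eps He.
    destruct (eventually_div_INR_lt 1 eps ltac:(lra) He) as [N HN].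
    exists N; intros n Hn; specialize (HN n Hn).
    assert (E : sum_n (fun k => / INR (S k) - / INR (S (S k))) n = 1 - / INR (S (S n))).
    { clear; induction n as [|n IH].
      - rewrite sum_O; simpl; field.
      - rewrite sum_n_RS, IH; Rring. }
    rewrite E; assert (H := pos_INR n).
    replace (1 - / INR (S (S n)) - 1) with (- / INR (S (S n))) by ring.
    rewrite Rabs_Ropp, Rabs_pos_eq by (left; apply Rinv_0_lt_compat, INR_S_pos).
    apply Rle_lt_trans with (2 := HN); unfold Rdiv; rewrite Rmult_1_l.
    rewrite !S_INR; apply Rinv_le_contravar; lra.
Qed.

Lemma cos_over_sqr_bound (x : R) (k : nat) :
  Rabs (cos (INR (S k) * x) / INR (S k) ^ 2) <= 1 / INR (S k) ^ 2.
Proof.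
  assert (H := INR_S_pos k).
  assert (0 < INR (S k) ^ 2) by (apply pow_lt; lra).
  unfold Rdiv; rewrite Rabs_mult, (Rabs_pos_eq (/ _)) by (left; now apply Rinv_0_lt_compat).
  apply Rmult_le_compat_r; [left; now apply Rinv_0_lt_compat|].
  apply Rabs_le, COS_bound.
Qed.

Lemma continuous_right_eq (f g : R -> R) (x d : R) : 0 < d ->
  (forall y, x < y < x + d -> f y = g y) -> continuous f x -> continuous g x -> f x = g x.
Proof.
  intros Hd Heq Hf Hg.
  apply (filterlim_locally_unique (F := at_right x) f).
  - apply filterlim_filter_le_1 with (2 := Hf); apply filter_le_within.
  - apply filterlim_ext_loc with g.
    + exists (mkposreal d Hd); intros y Hy Hxy; symmetry; apply Heq.
      change (Rabs (y - x) < d) in Hy; apply Rabs_def2 in Hy; lra.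
    + apply filterlim_filter_le_1 with (2 := Hg); apply filter_le_within.
Qed.

(** Integrates the sawtooth series. The derivative of a partial sum minus [q] is, up to sign, the
    sawtooth remainder, which is uniformly small on compact subintervals of the open period; hence
    the limit minus [q] is constant there. Continuity gives the end 0 and periodicity the end
    [2 * PI]. *)
Lemma is_series_cos_over_sqr : exists c, forall x, 0 <= x <= 2 * PI ->
  is_series (fun k => cos (INR (S k) * x) / INR (S k) ^ 2) (x ^ 2 / 4 - PI * x / 2 + c).
Proof.
  set (q := fun x => x ^ 2 / 4 - PI * x / 2).
  set (C := fun x => Series (fun k => cos (INR (S k) * x) / INR (S k) ^ 2)).
  assert (HPI := PI_RGT_0).
  assert (Hex : forall x, ex_series (fun k => cos (INR (S k) * x) / INR (S k) ^ 2)).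
  { intros x; exact (ex_series_dom _ _ (cos_over_sqr_bound x) ex_series_inv_sqr). }
  exists (C PI - q PI).
  cut (forall x, 0 <= x <= 2 * PI -> C x = q x + (C PI - q PI)).
  { intros H x Hx; fold (q x); rewrite <- (H x Hx); apply Series_correct, Hex. }
  assert (Hin : forall x, 0 < x < 2 * PI -> C x = q x + (C PI - q PI)).
  { intros x Hx.
    (* Chosen so that [[a, 2 PI - a]] contains the whole segment from [PI] to [x]. *)
    set (a := Rmin PI (Rmin x (2 * PI - x))).
    assert (Ha : 0 < a <= PI /\ a <= x <= 2 * PI - a).
    { unfold a; generalize (Rmin_l PI (Rmin x (2 * PI - x))) (Rmin_r PI (Rmin x (2 * PI - x)))
        (Rmin_l x (2 * PI - x)) (Rmin_r x (2 * PI - x)).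
      assert (0 < Rmin PI (Rmin x (2 * PI - x))) by (repeat apply Rmin_glb_lt; lra). lra. }
    destruct (sawtooth_remainder a (proj1 Ha)) as [K [HK H]].
    set (CN := fun N x => sum_n (fun k => cos (INR (S k) * x) / INR (S k) ^ 2) N).
    assert (HN : forall N, Rabs ((CN N x - q x) - (CN N PI - q PI)) <= K / (INR N + 1) * PI).
    { intros N.
      apply Rle_trans with (K / (INR N + 1) * Rabs (x - PI)).
      - apply (MVT_bound (fun y => CN N y - q y)
          (fun y => - (sum_n (fun k => sin (INR (S k) * y) / INR (S k)) N) - (y - PI) / 2) _ PI x).
        + intros y Hy.
          apply (@is_derive_minus R_AbsRing R_NormedModule).
          * rewrite <- (sum_n_Ropp (fun k => sin (INR (S k) * y) / INR (S k))).
            apply (is_derive_sum_n (fun k y => cos (INR (S k) * y) / INR (S k) ^ 2)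
               (fun k y => - (sin (INR (S k) * y) / INR (S k)))).
            intros k; generalize (INR (S k)) (INR_S_pos k); intros c P.
            auto_derive; [nra|]. field; lra.
          * unfold q; auto_derive; [trivial|]; field.
        + intros y Hy.
          rewrite <- Rabs_Ropp.
          replace (- (- sum_n (fun k => sin (INR (S k) * y) / INR (S k)) N - (y - PI) / 2))
            with (sum_n (fun k => sin (INR (S k) * y) / INR (S k)) N - (PI - y) / 2) by field.
          apply H; revert Hy; unfold Rmin, Rmax; destruct (Rle_dec PI x); lra.
      - apply Rmult_le_compat_l; [|apply Rabs_le; lra].
        apply Rmult_le_pos; [exact HK|]; left; apply Rinv_0_lt_compat.
        generalize (pos_INR N); lra. }
    apply Rminus_diag_uniq, Rabs_eq_0.
    apply Rle_antisym; [|apply Rabs_pos].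
    apply le_epsilon; intros eps He; rewrite Rplus_0_l.
    destruct (proj1 (is_series_eps _ _) (Series_correct _ (Hex x)) (eps / 3)) as [N1 H1]; [lra|].
    destruct (proj1 (is_series_eps _ _) (Series_correct _ (Hex PI)) (eps / 3)) as [N2 H2]; [lra|].
    destruct (eventually_div_INR_lt (K * PI) (eps / 3)) as [N3 H3]; [nra|lra|].
    set (N := (N1 + N2 + N3)%nat).
    specialize (H1 N ltac:(unfold N; lia)); specialize (H2 N ltac:(unfold N; lia)).
    specialize (H3 N ltac:(unfold N; lia)); specialize (HN N).
    fold (CN N x) in H1; fold (CN N PI) in H2; fold (C x) in H1; fold (C PI) in H2.
    replace (K / (INR N + 1) * PI) with (K * PI / (INR N + 1)) in HN by (unfold Rdiv; ring).
    apply Rabs_le_between in HN; apply Rabs_def2 in H1; apply Rabs_def2 in H2.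
    apply Rabs_le; lra. }
  assert (HC : forall x, continuous C x).
  { intros x; apply (continuous_Series _ (fun k => 1 / INR (S k) ^ 2)).
    - exact ex_series_inv_sqr.
    - apply filter_forall; intros y k; apply cos_over_sqr_bound.
    - intros k; apply (ex_derive_continuous (fun y => cos (INR (S k) * y) / INR (S k) ^ 2)).
      generalize (INR (S k)) (INR_S_pos k); intros c P; auto_derive; nra. }
  assert (Hq : forall x, continuous (fun x => q x + (C PI - q PI)) x).
  { intros x; apply (ex_derive_continuous (fun x => q x + (C PI - q PI))).
    unfold q; auto_derive; trivial. }
  assert (H0 : C 0 = q 0 + (C PI - q PI)).
  { apply (continuous_right_eq C (fun x => q x + (C PI - q PI)) 0 (2 * PI)); auto; try lra.
    intros; apply Hin; lra. }
  intros x Hx.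
  destruct (Req_dec x 0) as [->|Hx0]; [exact H0|].
  destruct (Req_dec x (2 * PI)) as [->|Hx1]; [|apply Hin; lra].
  transitivity (C 0).
  - apply Series_ext; intros k; f_equal.
    replace (INR (S k) * (2 * PI)) with (0 + 2 * INR (S k) * PI) by ring.
    now rewrite cos_period, Rmult_0_r.
  - rewrite H0; unfold q; field.
Qed.

(** * Poisson summation on a finite interval *)

Lemma ex_RInt_continuous_le (f : R -> R) (a b : R) : a <= b ->
  (forall x, a <= x <= b -> continuous f x) -> ex_RInt f a b.
Proof.
  intros Hab H; apply (ex_RInt_continuous f); intros x.
  rewrite Rmin_left, Rmax_right by exact Hab; apply H.
Qed.

Lemma ex_RInt_continuous_all (f : R -> R) (a b : R) :
  (forall x, continuous f x) -> ex_RInt f a b.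
Proof. intros H; apply (ex_RInt_continuous f); intros; apply H. Qed.

Lemma RInt_is_derive (f df : R -> R) (a b : R) : a <= b ->
  (forall x, a <= x <= b -> is_derive f x (df x)) ->
  (forall x, a <= x <= b -> continuous df x) ->
  RInt df a b = f b - f a.
Proof.
  intros Hab Hd Hc; apply is_RInt_unique, (is_RInt_derive f df);
    intros x; rewrite Rmin_left, Rmax_right by exact Hab; [apply Hd | apply Hc].
Qed.

Lemma is_derive_continuous (f : R -> R) (x l : R) : is_derive f x l -> continuous f x.
Proof. intros H; apply (ex_derive_continuous f); now exists l. Qed.

Lemma continuous_Rmult (f g : R -> R) (x : R) :
  continuous f x -> continuous g x -> continuous (fun y => f y * g y) x.
Proof. exact (continuous_mult f g x). Qed.

Lemma continuous_Rplus (f g : R -> R) (x : R) :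
  continuous f x -> continuous g x -> continuous (fun y => f y + g y) x.
Proof. exact (continuous_plus f g x). Qed.

Lemma continuous_cos_lin (c x : R) : continuous (fun y => cos (c * y)) x.
Proof. apply (ex_derive_continuous (fun y => cos (c * y))); auto_derive; trivial. Qed.

Lemma RInt_Rplus (f g : R -> R) (a b : R) : ex_RInt f a b -> ex_RInt g a b ->
  RInt (fun x => f x + g x) a b = RInt f a b + RInt g a b.
Proof. exact (RInt_plus f g a b). Qed.

Lemma RInt_Rscal (f : R -> R) (c a b : R) : ex_RInt f a b ->
  RInt (fun x => c * f x) a b = c * RInt f a b.
Proof. exact (RInt_scal f a b c). Qed.

Lemma RInt_cos_parts (g g1 g2 : R -> R) (a b c : R) : a <= b -> c <> 0 ->
  (forall x, a <= x <= b -> is_derive g x (g1 x)) ->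
  (forall x, a <= x <= b -> is_derive g1 x (g2 x)) ->
  (forall x, a <= x <= b -> continuous g2 x) ->
  RInt (fun x => g x * cos (c * x)) a b
  = (g b * sin (c * b) / c + g1 b * cos (c * b) / c ^ 2)
    - (g a * sin (c * a) / c + g1 a * cos (c * a) / c ^ 2)
    - RInt (fun x => g2 x * (cos (c * x) / c ^ 2)) a b.
Proof.
  intros Hab Hc H1 H2 H3.
  assert (C : forall x, continuous (fun y => cos (c * y) / c ^ 2) x).
  { intros x; apply (ex_derive_continuous (fun y => cos (c * y) / c ^ 2)).
    auto_derive; trivial. }
  assert (C1 : forall x, a <= x <= b -> continuous (fun x => g x * cos (c * x)) x).
  { intros x Hx; apply continuous_Rmult; [now apply is_derive_continuous with (g1 x), H1|].
    apply continuous_cos_lin. }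
  assert (C2 : forall x, a <= x <= b -> continuous (fun x => g2 x * (cos (c * x) / c ^ 2)) x).
  { intros x Hx; apply continuous_Rmult; [now apply H3 | apply C]. }
  assert (E := RInt_is_derive (fun x => g x * sin (c * x) / c + g1 x * cos (c * x) / c ^ 2)
    (fun x => g x * cos (c * x) + g2 x * (cos (c * x) / c ^ 2)) a b Hab).
  rewrite RInt_Rplus in E by (apply ex_RInt_continuous_le; assumption).
  rewrite <- E; [Rring| |].
  - intros x Hx.
    assert (D1 := H1 x Hx); assert (D2 := H2 x Hx).
    auto_derive.
    + repeat split; [exists (g1 x) | exists (g2 x)]; assumption.
    + replace (Derive (fun x => g x) x) with (g1 x) by (symmetry; now apply is_derive_unique).
      replace (Derive (fun x => g1 x) x) with (g2 x) by (symmetry; now apply is_derive_unique).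
      field; exact Hc.
  - intros x Hx; apply continuous_Rplus; [now apply C1 | now apply C2].
Qed.

Lemma continuous_bounded (f : R -> R) (a b : R) : a <= b ->
  (forall x, a <= x <= b -> continuous f x) ->
  exists K, 0 <= K /\ forall x, a <= x <= b -> Rabs (f x) <= K.
Proof.
  intros Hab Hf.
  destruct (continuity_ab_maj (fun x => Rabs (f x)) a b Hab) as [m [Hm _]].
  - intros x Hx; apply continuity_pt_filterlim.
    apply (continuous_comp f Rabs); [now apply Hf | apply continuous_Rabs].
  - exists (Rabs (f m)); split; [apply Rabs_pos | exact Hm].
Qed.

Lemma is_series_Rplus (a b : nat -> R) (la lb : R) :
  is_series a la -> is_series b lb -> is_series (fun k => a k + b k) (la + lb).
Proof. exact (is_series_plus a b la lb). Qed.

Lemma is_series_Rminus (a b : nat -> R) (la lb : R) :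
  is_series a la -> is_series b lb -> is_series (fun k => a k - b k) (la - lb).
Proof. exact (is_series_minus a b la lb). Qed.

Lemma is_series_Rscal (c : R) (a : nat -> R) (l : R) :
  is_series a l -> is_series (fun k => c * a k) (c * l).
Proof. exact (is_series_scal c a l). Qed.

(** The parameter [e] absorbs the jump of the sawtooth: it is 0 for [Y < 2 PI], and [PI / 2] for
    [Y = 2 PI], where the sine series sums to 0 instead of [- PI / 2]. Two integrations by parts
    turn the coefficients [1 / k] and [1 / k^2] of the boundary terms into the sawtooth and cosine
    series. *)
Lemma poisson_one_period (g g1 g2 : R -> R) (Y e : R) : 0 < Y <= 2 * PI ->
  (forall x, 0 <= x <= Y -> is_derive g x (g1 x)) ->
  (forall x, 0 <= x <= Y -> is_derive g1 x (g2 x)) ->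
  (forall x, 0 <= x <= Y -> continuous g2 x) ->
  is_series (fun k => sin (INR (S k) * Y) / INR (S k)) ((PI - Y) / 2 + e) ->
  is_series (fun k => RInt (fun x => g x * cos (INR (S k) * x)) 0 Y)
    (PI / 2 * g 0 + e * g Y - 1 / 2 * RInt g 0 Y).
Proof.
  intros HY H1 H2 H3 Hs.
  destruct is_series_cos_over_sqr as [c HC].
  set (q := fun x => x ^ 2 / 4 - PI * x / 2 + c).
  assert (HC' : forall x, 0 <= x <= 2 * PI ->
    is_series (fun k => cos (INR (S k) * x) / INR (S k) ^ 2) (q x)) by exact HC.
  assert (Cg : forall x, 0 <= x <= Y -> continuous g x)
    by (intros x Hx; now apply is_derive_continuous with (g1 x), H1).
  assert (Cq : forall x, continuous q x).
  { intros x; apply (ex_derive_continuous q); unfold q; auto_derive; trivial. }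
  assert (Cgq : forall x, 0 <= x <= Y -> continuous (fun x => g2 x * q x) x)
    by (intros x Hx; apply continuous_Rmult; [now apply H3 | apply Cq]).
  destruct (continuous_bounded g2 0 Y) as [K [HK HK2]]; [lra|assumption|].
  assert (HI : is_series (fun k => RInt (fun x => g2 x * (cos (INR (S k) * x) / INR (S k) ^ 2)) 0 Y)
    (RInt (fun x => g2 x * q x) 0 Y)).
  { apply is_series_RInt with (M := fun k => K * (1 / INR (S k) ^ 2)).
    - lra.
    - destruct ex_series_inv_sqr as [l Hl]; exists (K * l); now apply is_series_Rscal.
    - intros k; apply ex_RInt_continuous_le; [lra|]; intros x Hx.
      apply continuous_Rmult; [now apply H3|].
      apply (ex_derive_continuous (fun y => cos (INR (S k) * y) / INR (S k) ^ 2)).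
      generalize (INR (S k)) (INR_S_pos k); intros z P; auto_derive; trivial.
    - apply ex_RInt_continuous_le; [lra | exact Cgq].
    - intros k x Hx; rewrite Rabs_mult; apply Rmult_le_compat; try apply Rabs_pos;
        [now apply HK2 | apply cos_over_sqr_bound].
    - intros x Hx; apply is_series_Rscal, HC'; lra. }
  (* Integrates by parts twice in the opposite direction, moving the derivatives back onto [q], for
     which [q' = (x - PI) / 2] and [q'' = 1 / 2]. The terms [g1 * q] produced here cancel those of
     the series, and with them the unknown [c]. *)
  assert (EI : RInt (fun x => g2 x * q x) 0 Y =
    (g1 Y * q Y - g Y * (Y - PI) / 2) - (g1 0 * q 0 - g 0 * (0 - PI) / 2) + 1 / 2 * RInt g 0 Y).
  { assert (Xg : ex_RInt g 0 Y) by (apply ex_RInt_continuous_le; [lra | exact Cg]).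
    assert (E := RInt_is_derive (fun x => g1 x * q x - g x * (x - PI) / 2)
      (fun x => g2 x * q x + - (1 / 2) * g x) 0 Y).
    rewrite RInt_Rplus, RInt_Rscal in E.
    - rewrite <- E; [Rring|lra| |].
      + intros x Hx; assert (D1 := H1 x Hx); assert (D2 := H2 x Hx).
        unfold q; auto_derive.
        * repeat split; [exists (g2 x) | exists (g1 x)]; assumption.
        * replace (Derive (fun x => g x) x) with (g1 x) by (symmetry; now apply is_derive_unique).
          replace (Derive (fun x => g1 x) x) with (g2 x) by (symmetry; now apply is_derive_unique).
          field.
      + intros x Hx; apply continuous_Rplus; [now apply Cgq|].
        apply continuous_Rmult; [apply continuous_const | now apply Cg].
    - exact Xg.
    - apply ex_RInt_continuous_le; [lra | exact Cgq].
    - apply ex_RInt_continuous_le; [lra|]; intros x Hx.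
      apply continuous_Rmult; [apply continuous_const | now apply Cg]. }
  assert (HS := is_series_Rminus _ _ _ _
    (is_series_Rminus _ _ _ _
      (is_series_Rplus _ _ _ _ (is_series_Rscal (g Y) _ _ Hs)
        (is_series_Rscal (g1 Y) _ _ (HC' Y ltac:(lra))))
      (is_series_Rscal (g1 0) _ _ (HC' 0 ltac:(lra)))) HI).
  rewrite EI in HS.
  replace (PI / 2 * g 0 + e * g Y - 1 / 2 * RInt g 0 Y) with
    (g Y * ((PI - Y) / 2 + e) + g1 Y * q Y - g1 0 * q 0 -
     (g1 Y * q Y - g Y * (Y - PI) / 2 - (g1 0 * q 0 - g 0 * (0 - PI) / 2) + 1 / 2 * RInt g 0 Y))
    by field.
  revert HS; apply is_series_ext; intros k.
  assert (P := INR_S_pos k).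
  rewrite (RInt_cos_parts g g1 g2 0 Y (INR (S k))) by (assumption || lra).
  rewrite !Rmult_0_r, sin_0.
  Rfield; lra.
Qed.

(* At [X] the sine boundary terms cancel against those produced by integrating the closed form of
   the cosine series by parts. *)
Lemma poisson_finite (n : nat) : forall (g g1 g2 : R -> R) (X : R),
  2 * PI * INR n < X < 2 * PI * (INR n + 1) ->
  (forall x, 0 <= x <= X -> is_derive g x (g1 x)) ->
  (forall x, 0 <= x <= X -> is_derive g1 x (g2 x)) ->
  (forall x, 0 <= x <= X -> continuous g2 x) ->
  is_series (fun k => RInt (fun x => g x * cos (INR (S k) * x)) 0 X)
    (PI * (g 0 / 2 + sum_n_m (fun m => g (2 * PI * INR m)) 1 n) - 1 / 2 * RInt g 0 X).
Proof.
  assert (HPI := PI_RGT_0).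
  (* The functions and [X] remain quantified because the induction hypothesis is used for the
     translates by [2 * PI]. *)
  induction n as [|n IH]; intros g g1 g2 X HX H1 H2 H3.
  - simpl INR in HX.
    rewrite sum_n_m_zero by lia.
    assert (H := poisson_one_period g g1 g2 X 0 ltac:(lra) H1 H2 H3).
    rewrite Rplus_0_r in H; specialize (H (is_series_sawtooth X ltac:(lra))).
    replace (PI * (g 0 / 2 + zero) - 1 / 2 * RInt g 0 X) with
      (PI / 2 * g 0 + 0 * g X - 1 / 2 * RInt g 0 X); [exact H|].
    change (@zero (Ring.AbelianMonoid R_Ring)) with 0; change zero with 0; field.
  - rewrite S_INR in HX.
    assert (Hn := pos_INR n).
    assert (HX2 : 2 * PI < X) by nra.
    assert (Cg : forall x, 0 <= x <= X -> continuous g x)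
      by (intros x Hx; now apply is_derive_continuous with (g1 x), H1).
    assert (shift_derive : forall f df : R -> R, (forall x, 0 <= x <= X -> is_derive f x (df x)) ->
      forall x, 0 <= x <= X - 2 * PI -> is_derive (fun x => f (x + 2 * PI)) x (df (x + 2 * PI))).
    { intros f df Hf x Hx.
      replace (df (x + 2 * PI)) with (scal 1 (df (x + 2 * PI))) by apply Rmult_1_l.
      apply (is_derive_comp f (fun x => x + 2 * PI)); [apply Hf; lra|].
      auto_derive; trivial. }
    assert (shift_cont : forall f : R -> R, (forall x, 0 <= x <= X -> continuous f x) ->
      forall x, 0 <= x <= X - 2 * PI -> continuous (fun x => f (x + 2 * PI)) x).
    { intros f Hf x Hx; apply (continuous_comp (fun x => x + 2 * PI) f); [|apply Hf; lra].
      apply (ex_derive_continuous (fun x => x + 2 * PI)); auto_derive; trivial. }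
    assert (split : forall f : R -> R, (forall x, 0 <= x <= X -> continuous f x) ->
      RInt f 0 X = RInt f 0 (2 * PI) + RInt (fun x => f (x + 2 * PI)) 0 (X - 2 * PI)).
    { intros f Hf.
      assert (X1 : ex_RInt f 0 (2 * PI)) by (apply ex_RInt_continuous_le; [lra|intros; apply Hf; lra]).
      assert (X2 : ex_RInt f (2 * PI) X) by (apply ex_RInt_continuous_le; [lra|intros; apply Hf; lra]).
      assert (E : RInt f 0 (2 * PI) + RInt f (2 * PI) X = RInt f 0 X)
        by exact (RInt_Chasles f 0 (2 * PI) X X1 X2).
      rewrite <- E; f_equal.
      assert (E2 := RInt_comp_lin f 1 (2 * PI) 0 (X - 2 * PI)).
      replace (1 * 0 + 2 * PI) with (2 * PI) in E2 by ring.
      replace (1 * (X - 2 * PI) + 2 * PI) with X in E2 by ring.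
      rewrite <- (E2 X2); apply RInt_ext; intros x _.
      change (1 * f (1 * x + 2 * PI) = f (x + 2 * PI)); now rewrite !Rmult_1_l. }
    (* All terms are 0, which corresponds to [e = PI / 2] at the end of a full period. *)
    assert (A : is_series (fun k => sin (INR (S k) * (2 * PI)) / INR (S k)) ((PI - 2 * PI) / 2 + PI / 2)).
    { replace ((PI - 2 * PI) / 2 + PI / 2) with 0 by field.
      apply is_series_eps; intros eps He; exists 0%nat; intros m _.
      rewrite (sum_n_ext _ (fun _ => 0)).
      - rewrite sum_n_const; replace (INR (S m) * 0 - 0) with 0 by ring; now rewrite Rabs_R0.
      - intros k; replace (INR (S k) * (2 * PI)) with (INR (2 * S k) * PI)
          by (rewrite mult_INR; simpl (INR 2); ring).
        rewrite sin_INR_PI; unfold Rdiv; apply Rmult_0_l. }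
    (* The value [g (2 PI)] receives half its weight from the right end of this period and the other
       half from the left end of the translate. *)
    assert (B1 := poisson_one_period g g1 g2 (2 * PI) (PI / 2) ltac:(lra)
      ltac:(intros; apply H1; lra) ltac:(intros; apply H2; lra) ltac:(intros; apply H3; lra) A).
    assert (B2 := IH (fun x => g (x + 2 * PI)) (fun x => g1 (x + 2 * PI)) (fun x => g2 (x + 2 * PI))
      (X - 2 * PI) ltac:(lra) (shift_derive g g1 H1) (shift_derive g1 g2 H2) (shift_cont g2 H3)).
    assert (B := is_series_Rplus _ _ _ _ B1 B2); cbv beta in B.
    rewrite (split g Cg).
    assert (Es : sum_n_m (fun m => g (2 * PI * INR m)) 1 (S n)
      = g (2 * PI) + sum_n_m (fun m => g (2 * PI * INR m + 2 * PI)) 1 n).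
    { rewrite sum_Sn_m by lia.
      change (g (2 * PI * INR 1) + sum_n_m (fun m => g (2 * PI * INR m)) 2 (S n)
        = g (2 * PI) + sum_n_m (fun m => g (2 * PI * INR m + 2 * PI)) 1 n).
      rewrite <- (sum_n_m_S (fun m => g (2 * PI * INR m))).
      simpl (INR 1); rewrite Rmult_1_r; f_equal.
      apply sum_n_m_ext; intros m; f_equal; rewrite S_INR; ring. }
    rewrite Es; rewrite Rplus_0_l in B.
    match goal with |- is_series _ ?l => match type of B with is_series _ ?l' =>
      replace l with l' by field end end.
    revert B; apply is_series_ext; intros k.
    rewrite (split (fun x => g x * cos (INR (S k) * x))).
    + apply (f_equal (fun z => _ + z)); apply RInt_ext; intros x _; f_equal.
      replace (INR (S k) * (x + 2 * PI)) with (INR (S k) * x + 2 * INR (S k) * PI) by ring.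
      now rewrite cos_period.
    + intros x Hx; apply continuous_Rmult; [now apply Cg | apply continuous_cos_lin].
Qed.

(** * The integral representation of J0 *)

Lemma continuous_sin_pow (n : nat) (x : R) : continuous (fun y => sin y ^ n) x.
Proof. apply (ex_derive_continuous (fun y => sin y ^ n)); auto_derive; trivial. Qed.

(** Wallis's formula. The function [sin^(m+1) * cos] vanishes at both ends, and integrating its
    derivative gives [(m + 1) I_m = (m + 2) I_(m+2)]. *)
Lemma RInt_sin_pow_even (j : nat) :
  RInt (fun x => sin x ^ (2 * j)) 0 (PI / 2)
  = PI / 2 * (INR (fact (2 * j)) / (4 ^ j * INR (fact j) ^ 2)).
Proof.
  assert (HPI := PI_RGT_0).
  assert (X : forall n, ex_RInt (fun y => sin y ^ n) 0 (PI / 2))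
    by (intros n; apply ex_RInt_continuous_le; [lra | intros; apply continuous_sin_pow]).
  assert (XS : forall c n, ex_RInt (fun y => c * sin y ^ n) 0 (PI / 2))
    by (intros c n; apply ex_RInt_continuous_le; [lra|]; intros; apply continuous_Rmult;
        [apply continuous_const | apply continuous_sin_pow]).
  induction j as [|j IH].
  - simpl (2 * 0)%nat; simpl pow; rewrite RInt_const; simpl; change (scal ?a ?b) with (a * b); Rfield.
  - set (m := (2 * j)%nat) in *.
    replace (2 * S j)%nat with (S (S m)) by (unfold m; lia).
    assert (E := RInt_is_derive (fun x => sin x ^ S m * cos x)
      (fun x => (INR m + 1) * sin x ^ m + - (INR m + 2) * sin x ^ S (S m)) 0 (PI / 2)).
    rewrite (RInt_Rplus _ _ _ _ (XS (INR m + 1) m) (XS (- (INR m + 2)) (S (S m)))),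
      (RInt_Rscal _ _ _ _ (X m)), (RInt_Rscal _ _ _ _ (X (S (S m)))) in E.
    rewrite cos_PI2, sin_0, IH in E.
    assert (E' : (INR m + 1) * (PI / 2 * (INR (fact m) / (4 ^ j * INR (fact j) ^ 2)))
      + - (INR m + 2) * RInt (fun x => sin x ^ S (S m)) 0 (PI / 2) = 0).
    { rewrite E; [simpl; ring|lra| |].
      - intros x _; auto_derive; [trivial|].
        assert (Q := sin2_cos2 x); unfold Rsqr in Q.
        simpl pow.
        change (match m with 0%nat => 1 | S _ => INR m + 1 end) with (INR (S m)); rewrite S_INR.
        transitivity ((INR m + 1) * sin x ^ m * (cos x * cos x) - sin x ^ m * (sin x * sin x)).
        + ring.
        + replace (cos x * cos x) with (1 - sin x * sin x) by lra; ring.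
      - intros x _; apply (ex_derive_continuous
          (fun x => (INR m + 1) * sin x ^ m + - (INR m + 2) * sin x ^ S (S m))).
        auto_derive; trivial. }
    assert (Hm : INR m = 2 * INR j) by (unfold m; rewrite mult_INR; simpl (INR 2); ring).
    assert (F1 := INR_fact_neq_0 j); assert (F2 := INR_fact_neq_0 m).
    assert (Hj := pos_INR j).
    apply Rmult_eq_reg_l with (INR m + 2); [|lra].
    transitivity ((INR m + 1) * (PI / 2 * (INR (fact m) / (4 ^ j * INR (fact j) ^ 2)))); [lra|].
    rewrite !fact_simpl, !mult_INR, !S_INR, Hm; simpl pow.
    field; repeat split; try lra; apply pow_nonzero; lra.
Qed.

Lemma is_series_cos (x : R) :
  is_series (fun j => (-1) ^ j / INR (fact (2 * j)) * x ^ (2 * j)) (cos x).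
Proof.
  unfold cos; destruct (exist_cos (Rsqr x)) as [l Hl].
  apply is_series_Reals in Hl; revert Hl; apply is_series_ext; intros j.
  unfold cos_n; rewrite pow_mult; unfold Rsqr; simpl pow; now rewrite Rmult_1_r.
Qed.

Lemma ex_series_even_exp (z : R) :
  ex_series (fun j => z ^ (2 * j) / INR (fact (2 * j))).
Proof.
  apply ex_series_dom with (fun j => / INR (fact j) * (z ^ 2) ^ j).
  - intros j; rewrite pow_mult.
    assert (P : 0 <= (z ^ 2) ^ j) by (apply pow_le; nra).
    assert (F1 := INR_fact_lt_0 j); assert (F2 := INR_fact_lt_0 (2 * j)).
    rewrite Rabs_pos_eq.
    + unfold Rdiv; rewrite Rmult_comm; apply Rmult_le_compat_r; [exact P|].
      apply Rinv_le_contravar; [exact F1|]; apply le_INR, fact_le; lia.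
    + apply Rmult_le_pos; [exact P | left; now apply Rinv_0_lt_compat].
  - exists (exp (z ^ 2)); apply is_pseries_R, is_exp_Reals.
Qed.

Definition bessel_integral (z : R) : R := 2 / PI * RInt (fun x => cos (z * sin x)) 0 (PI / 2).
(** This and [bessel_integral2] are the first two derivatives of [bessel_integral] under the
    integral sign; this one is minus the Bessel function of order 1. *)
Definition bessel_integral1 (z : R) : R :=
  - (2 / PI * RInt (fun x => sin x * sin (z * sin x)) 0 (PI / 2)).
Definition bessel_integral2 (z : R) : R :=
  - (2 / PI * RInt (fun x => sin x ^ 2 * cos (z * sin x)) 0 (PI / 2)).

(** Expands the cosine and integrates termwise: the factor [(2 j)!] of Wallis's formula cancels the
    one in the cosine series and leaves [4^j (j!)^2]. *)
Lemma J0_integral (z : R) : J0 z = bessel_integral z.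
Proof.
  assert (HPI := PI_RGT_0).
  unfold J0; apply is_series_unique.
  assert (H : is_series (fun j => RInt (fun x => (-1) ^ j / INR (fact (2 * j)) * (z * sin x) ^ (2 * j)) 0 (PI / 2))
    (RInt (fun x => cos (z * sin x)) 0 (PI / 2))).
  { apply is_series_RInt with (M := fun j => z ^ (2 * j) / INR (fact (2 * j))).
    - lra.
    - apply ex_series_even_exp.
    - intros j; apply ex_RInt_continuous_le; [lra|]; intros x _.
      generalize (2 * j)%nat ((-1) ^ j / INR (fact (2 * j))); intros m c.
      apply (ex_derive_continuous (fun x => c * (z * sin x) ^ m)); auto_derive; trivial.
    - apply ex_RInt_continuous_le; [lra|]; intros x _.
      apply (ex_derive_continuous (fun x => cos (z * sin x))); auto_derive; trivial.
    - intros j x _.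
      assert (F := INR_fact_lt_0 (2 * j)).
      unfold Rdiv; rewrite !Rabs_mult, pow_1_abs, Rmult_1_l, Rabs_inv, (Rabs_pos_eq (INR _)) by lra.
      rewrite Rmult_comm; apply Rmult_le_compat_r; [left; now apply Rinv_0_lt_compat|].
      rewrite !pow_mult, Rabs_pos_eq by (apply pow_le; nra).
      apply pow_incr; split; [nra|].
      assert (B := SIN_bound x); assert (sin x ^ 2 <= 1) by nra.
      rewrite Rpow_mult_distr; assert (0 <= z ^ 2) by nra; nra.
    - intros x _; apply is_series_cos. }
  apply (is_series_Rscal (2 / PI)) in H; revert H; apply is_series_ext; intros j.
  assert (F1 := INR_fact_neq_0 j); assert (F2 := INR_fact_neq_0 (2 * j)).
  transitivity (2 / PI * RInt (fun x => (-1) ^ j / INR (fact (2 * j)) * z ^ (2 * j) * sin x ^ (2 * j)) 0 (PI / 2)).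
  { f_equal; apply RInt_ext; intros x _; rewrite Rpow_mult_distr; apply eq_sym, Rmult_assoc. }
  rewrite RInt_Rscal by (apply ex_RInt_continuous_le; [lra | intros; apply continuous_sin_pow]).
  rewrite RInt_sin_pow_even.
  unfold Rdiv at 6; rewrite Rpow_mult_distr, (pow_mult (/ 2)).
  replace ((/ 2) ^ 2) with (/ 4) by field; rewrite pow_inv.
  Rfield; repeat split; try lra; apply pow_nonzero; lra.
Qed.

Lemma continuity_2d_pt_sin_mul (x y : R) : continuity_2d_pt (fun u v => u * sin v) x y.
Proof.
  apply continuity_2d_pt_mult; [apply continuity_2d_pt_id1|].
  apply (continuity_1d_2d_pt_comp sin); [apply continuity_sin | apply continuity_2d_pt_id2].
Qed.

Lemma continuity_2d_pt_sin_pow (n : nat) (x y : R) : continuity_2d_pt (fun u v => sin v ^ n) x y.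
Proof.
  apply (continuity_1d_2d_pt_comp (fun v => sin v ^ n)); [|apply continuity_2d_pt_id2].
  apply continuity_pt_filterlim, continuous_sin_pow.
Qed.

Lemma is_derive_RInt_cont (f df : R -> R -> R) (a b x : R) : a <= b ->
  (forall u t, is_derive (fun z => f z t) u (df u t)) ->
  (forall u t, continuous (f u) t) ->
  (forall t, continuity_2d_pt df x t) ->
  is_derive (fun u => RInt (f u) a b) x (RInt (df x) a b).
Proof.
  intros Hab Hd Hc Hdc.
  assert (E : forall u t, Derive (fun z => f z t) u = df u t)
    by (intros; apply is_derive_unique, Hd).
  replace (RInt (df x) a b) with (RInt (fun t => Derive (fun u => f u t) x) a b)
    by (apply RInt_ext; intros; apply E).
  apply is_derive_RInt_param.
  - apply filter_forall; intros u t _; exists (df u t); apply Hd.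
  - intros t _; apply continuity_2d_pt_ext with df; [|apply Hdc].
    intros u v; symmetry; apply E.
  - apply filter_forall; intros u; apply ex_RInt_continuous_le; [exact Hab | intros; apply Hc].
Qed.

Lemma is_derive_bessel_integral (z : R) : is_derive bessel_integral z (bessel_integral1 z).
Proof.
  assert (HPI := PI_RGT_0).
  assert (H := is_derive_RInt_cont (fun z x => cos (z * sin x))
    (fun z x => -1 * (sin x ^ 1 * sin (z * sin x))) 0 (PI / 2) z ltac:(lra)).
  unfold bessel_integral1.
  replace (- (2 / PI * RInt (fun x => sin x * sin (z * sin x)) 0 (PI / 2)))
    with (2 / PI * RInt (fun x => -1 * (sin x ^ 1 * sin (z * sin x))) 0 (PI / 2)).
  - refine (is_derive_scal _ _ (2 / PI) _ (H _ _ _)).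
    + intros u t; auto_derive; [trivial | ring].
    + intros u t; apply (ex_derive_continuous (fun x => cos (u * sin x))); auto_derive; trivial.
    + intros t; apply continuity_2d_pt_mult; [apply continuity_2d_pt_const|].
      apply continuity_2d_pt_mult; [apply continuity_2d_pt_sin_pow|].
      apply (continuity_1d_2d_pt_comp sin); [apply continuity_sin | apply continuity_2d_pt_sin_mul].
  - rewrite RInt_Rscal.
    + rewrite (RInt_ext _ (fun x => sin x * sin (z * sin x))); [ring|].
      intros x _; now rewrite pow_1.
    + apply ex_RInt_continuous_le; [lra|]; intros x _.
      apply (ex_derive_continuous (fun x => sin x ^ 1 * sin (z * sin x))); auto_derive; trivial.
Qed.

Lemma is_derive_bessel_integral1 (z : R) : is_derive bessel_integral1 z (bessel_integral2 z).
Proof.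
  assert (HPI := PI_RGT_0).
  assert (H := is_derive_RInt_cont (fun z x => sin x * sin (z * sin x))
    (fun z x => sin x ^ 2 * cos (z * sin x)) 0 (PI / 2) z ltac:(lra)).
  refine (is_derive_opp _ _ _ (is_derive_scal _ _ (2 / PI) _ (H _ _ _))).
  - intros u t; auto_derive; [trivial | ring].
  - intros u t; apply (ex_derive_continuous (fun x => sin x * sin (u * sin x))); auto_derive; trivial.
  - intros t; apply continuity_2d_pt_mult; [apply continuity_2d_pt_sin_pow|].
    apply (continuity_1d_2d_pt_comp cos); [apply continuity_cos | apply continuity_2d_pt_sin_mul].
Qed.

(** The left side is a mean value over an interval of length [PI / 2]. The bounds by 1 that follow
    for the Bessel integral and its two derivatives are uniform in [z], so the majorants of the heat
    series do not depend on [r]. *)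
Lemma mean_bound (f : R -> R) :
  (forall x, continuous f x) -> (forall x, Rabs (f x) <= 1) ->
  Rabs (2 / PI * RInt f 0 (PI / 2)) <= 1.
Proof.
  assert (HPI := PI_RGT_0); intros Hc Hb.
  assert (B : Rabs (RInt f 0 (PI / 2)) <= (PI / 2 - 0) * 1).
  { apply abs_RInt_le_const; [lra| |intros; apply Hb].
    apply ex_RInt_continuous_le; [lra | intros; apply Hc]. }
  assert (P : 0 < 2 / PI) by (apply Rdiv_lt_0_compat; lra).
  rewrite Rabs_mult, (Rabs_pos_eq (2 / PI)) by lra.
  apply Rmult_le_reg_l with (PI / 2); [lra|].
  replace (PI / 2 * (2 / PI * Rabs (RInt f 0 (PI / 2)))) with (Rabs (RInt f 0 (PI / 2)))
    by (Rfield; lra).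
  lra.
Qed.

Lemma Rabs_mult_le_1 (a b : R) : Rabs a <= 1 -> Rabs b <= 1 -> Rabs (a * b) <= 1.
Proof.
  intros Ha Hb; rewrite Rabs_mult, <- (Rmult_1_r 1).
  apply Rmult_le_compat; auto using Rabs_pos.
Qed.

Lemma bessel_integral_bound (z : R) : Rabs (bessel_integral z) <= 1.
Proof.
  apply mean_bound; intros x; [|apply Rabs_le, COS_bound].
  apply (ex_derive_continuous (fun x => cos (z * sin x))); auto_derive; trivial.
Qed.

Lemma bessel_integral1_bound (z : R) : Rabs (bessel_integral1 z) <= 1.
Proof.
  unfold bessel_integral1; rewrite Rabs_Ropp; apply mean_bound; intros x.
  - apply (ex_derive_continuous (fun x => sin x * sin (z * sin x))); auto_derive; trivial.
  - apply Rabs_mult_le_1; apply Rabs_le, SIN_bound.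
Qed.

Lemma bessel_integral2_bound (z : R) : Rabs (bessel_integral2 z) <= 1.
Proof.
  unfold bessel_integral2; rewrite Rabs_Ropp; apply mean_bound; intros x.
  - apply (ex_derive_continuous (fun x => sin x ^ 2 * cos (z * sin x))); auto_derive; trivial.
  - apply Rabs_mult_le_1; [|apply Rabs_le, COS_bound].
    simpl; rewrite Rmult_1_r; apply Rabs_mult_le_1; apply Rabs_le, SIN_bound.
Qed.

(* Integrate the derivative of [cos x * sin (z * sin x)], which vanishes at both ends. *)
Lemma bessel_equation (z : R) :
  z * bessel_integral2 z + bessel_integral1 z + z * bessel_integral z = 0.
Proof.
  assert (HPI := PI_RGT_0).
  unfold bessel_integral, bessel_integral1, bessel_integral2.
  set (f0 := fun x => cos (z * sin x)).
  set (f1 := fun x => sin x * sin (z * sin x)).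
  set (f2 := fun x => sin x ^ 2 * cos (z * sin x)).
  assert (X : forall f : R -> R, (forall x, ex_derive f x) -> ex_RInt f 0 (PI / 2)).
  { intros f Hf; apply ex_RInt_continuous_le; [lra|]; intros x _.
    apply (ex_derive_continuous f), Hf. }
  assert (D0 : forall x, ex_derive f0 x) by (intros; unfold f0; auto_derive; trivial).
  assert (D1 : forall x, ex_derive f1 x) by (intros; unfold f1; auto_derive; trivial).
  assert (D2 : forall x, ex_derive f2 x) by (intros; unfold f2; auto_derive; trivial).
  assert (E := RInt_is_derive (fun x => cos x * sin (z * sin x))
    (fun x => (z * f0 x + - z * f2 x) + -1 * f1 x) 0 (PI / 2) ltac:(lra)).
  rewrite RInt_Rplus, RInt_Rplus, !RInt_Rscal in E;
    try (apply X; intros x; auto_derive; auto).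
  rewrite cos_PI2, sin_0, Rmult_0_r, sin_0 in E.
  assert (E' : z * RInt f0 0 (PI / 2) + - z * RInt f2 0 (PI / 2) + -1 * RInt f1 0 (PI / 2) = 0).
  { rewrite E; [ring| |].
    - intros x _; auto_derive; [trivial|].
      unfold f0, f1, f2.
      assert (Q := sin2_cos2 x); unfold Rsqr in Q.
      replace (sin x ^ 2) with (1 - cos x * cos x) by (simpl; lra); ring.
    - intros x _; apply (ex_derive_continuous (fun x => (z * f0 x + - z * f2 x) + -1 * f1 x)).
      auto_derive; auto. }
  transitivity (2 / PI * (z * RInt f0 0 (PI / 2) + - z * RInt f2 0 (PI / 2) + -1 * RInt f1 0 (PI / 2))).
  - ring.
  - rewrite E'; ring.
Qed.

(** * Schlomilch's series at time 0 *)

Lemma sin_half_neq_0 (n : nat) (x : R) :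
  2 * PI * INR n < x < 2 * PI * (INR n + 1) -> sin (x / 2) <> 0.
Proof.
  intros Hx H; assert (HPI := PI_RGT_0).
  destruct (sin_eq_0_0 _ H) as [k Hk].
  assert (A1 : INR n < IZR k) by nra.
  assert (A2 : IZR k < INR n + 1) by nra.
  rewrite INR_IZR_INZ in A1, A2; rewrite <- plus_IZR in A2.
  apply lt_IZR in A1; apply lt_IZR in A2; lia.
Qed.

Lemma inv_sqrt_derivatives (r x : R) : Rabs x < r ->
  is_derive (fun x => 1 / sqrt (r ^ 2 - x ^ 2)) x (x / sqrt (r ^ 2 - x ^ 2) ^ 3) /\
  is_derive (fun x => x / sqrt (r ^ 2 - x ^ 2) ^ 3) x
    (1 / sqrt (r ^ 2 - x ^ 2) ^ 3 + 3 * x ^ 2 / sqrt (r ^ 2 - x ^ 2) ^ 5) /\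
  continuous (fun x => 1 / sqrt (r ^ 2 - x ^ 2) ^ 3 + 3 * x ^ 2 / sqrt (r ^ 2 - x ^ 2) ^ 5) x.
Proof.
  intros Hx; apply Rabs_def2 in Hx.
  assert (P : 0 < r ^ 2 - x ^ 2) by nra.
  assert (Q := sqrt_lt_R0 _ P).
  assert (Q2 : forall k, sqrt (r ^ 2 - x ^ 2) ^ k <> 0) by (intros; apply pow_nonzero; lra).
  split; [|split].
  - auto_derive; change (r * (r * 1) + - (x * (x * 1))) with (r ^ 2 - x ^ 2).
    + repeat split; lra.
    + field; lra.
  - auto_derive; change (r * (r * 1) + - (x * (x * 1))) with (r ^ 2 - x ^ 2).
    + repeat split; [lra|apply (Q2 3%nat)].
    + simpl INR; field; lra.
  - apply (ex_derive_continuous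
      (fun x => 1 / sqrt (r ^ 2 - x ^ 2) ^ 3 + 3 * x ^ 2 / sqrt (r ^ 2 - x ^ 2) ^ 5)).
    auto_derive; change (r * (r * 1) + - (x * (x * 1))) with (r ^ 2 - x ^ 2).
    repeat split; try lra; [apply (Q2 3%nat) | apply (Q2 5%nat)].
Qed.

Lemma sin_lt_1_of_lt_PI2 (x : R) : 0 <= x < PI / 2 -> 0 <= sin x < 1.
Proof.
  intros Hx; assert (HPI := PI_RGT_0).
  split; [apply sin_ge_0; lra|].
  rewrite <- sin_PI2; apply sin_increasing_1; lra.
Qed.

(** Substitution [x = r sin y], whose Jacobian [r cos y] cancels the weight. With [th < PI / 2] the
    range stays below the singularity [x = r]. *)
Lemma RInt_comp_sin (f : R -> R) (r th : R) : 0 < r -> 0 <= th < PI / 2 ->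
  (forall x, 0 <= x <= r * sin th -> continuous f x) ->
  RInt (fun x => 1 / sqrt (r ^ 2 - x ^ 2) * f x) 0 (r * sin th)
  = RInt (fun y => f (r * sin y)) 0 th.
Proof.
  intros Hr Hth Hf; assert (HPI := PI_RGT_0).
  assert (M : forall y, 0 <= y <= th -> 0 <= r * sin y <= r * sin th).
  { intros y Hy; assert (S := sin_lt_1_of_lt_PI2 y ltac:(lra)).
    assert (sin y <= sin th) by (apply sin_incr_1; lra). nra. }
  assert (S := sin_lt_1_of_lt_PI2 th Hth).
  assert (E := RInt_comp (fun x => 1 / sqrt (r ^ 2 - x ^ 2) * f x)
    (fun y => r * sin y) (fun y => r * cos y) 0 th).
  cbv beta in E; rewrite sin_0, Rmult_0_r in E; rewrite <- E.
  - apply RInt_ext; intros y; rewrite Rmin_left, Rmax_right by lra; intros Hy.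
    change (r * cos y * (1 / sqrt (r ^ 2 - (r * sin y) ^ 2) * f (r * sin y)) = f (r * sin y)).
    assert (C : 0 < cos y) by (apply cos_gt_0; lra).
    replace (r ^ 2 - (r * sin y) ^ 2) with ((r * cos y) * (r * cos y)).
    + rewrite sqrt_square by nra; field; lra.
    + assert (Q := sin2_cos2 y); unfold Rsqr in Q.
      replace (r ^ 2 - (r * sin y) ^ 2) with (r ^ 2 * (1 - sin y * sin y)) by ring.
      replace (1 - sin y * sin y) with (cos y * cos y) by lra; ring.
  - intros y; rewrite Rmin_left, Rmax_right by lra; intros Hy.
    assert (My := M y Hy); apply continuous_Rmult; [|now apply Hf].
    apply is_derive_continuous with (r * sin y / sqrt (r ^ 2 - (r * sin y) ^ 2) ^ 3).
    apply (inv_sqrt_derivatives r (r * sin y)); rewrite Rabs_pos_eq; nra.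
  - intros y _; split; [auto_derive; [trivial|ring]|].
    apply (ex_derive_continuous (fun y => r * cos y)); auto_derive; trivial.
Qed.

Lemma continuous_cos_sin (c x : R) : continuous (fun y => cos (c * sin y)) x.
Proof. apply (ex_derive_continuous (fun y => cos (c * sin y))); auto_derive; trivial. Qed.

(** [poisson_finite] at [X = r sin th]; under the substitution the integral of the weight itself is
    [th]. As [X] exceeds [2 PI n], all [n] sampling points are already included. *)
Lemma schlomilch_head (n : nat) (r th : R) : 0 < r -> 0 <= th < PI / 2 ->
  2 * PI * INR n < r * sin th < 2 * PI * (INR n + 1) ->
  is_series (fun k => RInt (fun y => cos (INR (S k) * r * sin y)) 0 th)
    (PI * (1 / (2 * r) + sum_n_m (fun m => 1 / sqrt (r ^ 2 - 4 * INR m ^ 2 * PI ^ 2)) 1 n)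
     - th / 2).
Proof.
  intros Hr Hth HX.
  set (g := fun x => 1 / sqrt (r ^ 2 - x ^ 2)).
  assert (S := sin_lt_1_of_lt_PI2 th Hth).
  assert (A : forall x, 0 <= x <= r * sin th -> Rabs x < r).
  { intros x Hx; rewrite Rabs_pos_eq; nra. }
  assert (P := poisson_finite n g (fun x => x / sqrt (r ^ 2 - x ^ 2) ^ 3)
    (fun x => 1 / sqrt (r ^ 2 - x ^ 2) ^ 3 + 3 * x ^ 2 / sqrt (r ^ 2 - x ^ 2) ^ 5)
    (r * sin th) HX
    (fun x Hx => proj1 (inv_sqrt_derivatives r x (A x Hx)))
    (fun x Hx => proj1 (proj2 (inv_sqrt_derivatives r x (A x Hx))))
    (fun x Hx => proj2 (proj2 (inv_sqrt_derivatives r x (A x Hx))))).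
  assert (E0 : RInt g 0 (r * sin th) = th).
  { transitivity (RInt (fun x => g x * 1) 0 (r * sin th)).
    - apply RInt_ext; intros; symmetry; apply Rmult_1_r.
    - unfold g; rewrite (RInt_comp_sin (fun _ => 1)) by
        (try apply Hr; try apply Hth; intros; apply continuous_const).
      rewrite RInt_const; change (scal ?a ?b) with (a * b); Rring. }
  rewrite E0 in P.
  assert (G0 : g 0 = 1 / r).
  { unfold g; replace (r ^ 2 - 0 ^ 2) with (r * r) by ring; rewrite sqrt_square; lra. }
  rewrite G0 in P.
  rewrite (sum_n_m_ext _ (fun m => g (2 * PI * INR m))).
  - replace (PI * (1 / (2 * r) + sum_n_m (fun m => g (2 * PI * INR m)) 1 n) - th / 2)
      with (PI * (1 / r / 2 + sum_n_m (fun m => g (2 * PI * INR m)) 1 n) - 1 / 2 * th)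
      by (field; lra).
    revert P; apply is_series_ext; intros k.
    unfold g; rewrite (RInt_comp_sin (fun x => cos (INR (Datatypes.S k) * x))) by
      (try apply Hr; try apply Hth; intros; apply continuous_cos_lin).
    apply RInt_ext; intros y _; now rewrite Rmult_assoc.
  - intros m; unfold g; do 2 f_equal; ring.
Qed.

(** Sums under the integral first: for [r sin y] inside the annulus the Dirichlet kernel is bounded
    independently of [N], so the bound is proportional to the length of the interval. *)
Lemma schlomilch_tail (n : nat) (r : R) :
  2 * PI * INR n < r < 2 * PI * (INR n + 1) ->
  exists th0 K, 0 <= th0 < PI / 2 /\ 0 <= K /\ 2 * PI * INR n < r * sin th0 /\
  forall th N, th0 <= th <= PI / 2 ->
  Rabs (sum_n (fun k => RInt (fun y => cos (INR (S k) * r * sin y)) th (PI / 2)) N)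
  <= (PI / 2 - th) * K.
Proof.
  intros Hr; assert (HPI := PI_RGT_0); assert (Hn := pos_INR n).
  assert (Hr0 : 0 < r) by nra.
  (* The midpoint between [2 PI n / r] and 1, so that [[r s, r]] lies inside the annulus and
     [sin (x / 2)] has no zero on it. *)
  set (s := (2 * PI * INR n / r + 1) / 2).
  assert (Hs0 : 0 <= 2 * PI * INR n / r < 1).
  { split; [apply Rmult_le_pos; [nra | left; now apply Rinv_0_lt_compat]|].
    apply Rmult_lt_reg_r with r; [lra|]; unfold Rdiv; rewrite Rmult_assoc, Rinv_l; lra. }
  assert (Hs : 0 <= s < 1) by (unfold s; lra).
  assert (Hsr : 2 * PI * INR n < r * s).
  { replace (2 * PI * INR n) with (r * (2 * PI * INR n / r)) by (field; lra).
    apply Rmult_lt_compat_l; unfold s; lra. }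
  assert (Hsin : sin (asin s) = s) by (apply sin_asin; lra).
  assert (Hth0 : 0 <= asin s < PI / 2).
  { assert (B := asin_bound_lt s ltac:(lra)).
    split; [|lra]; apply Rnot_lt_le; intros Hlt.
    assert (P := sin_gt_0 (- asin s) ltac:(lra) ltac:(lra)).
    rewrite sin_neg, Hsin in P; lra. }
  destruct (continuous_bounded (fun x => / (2 * sin (x / 2))) (r * s) r) as [K [HK HK2]].
  { nra. }
  { intros x Hx; assert (sin (x / 2) <> 0) by (apply sin_half_neq_0 with n; lra).
    apply (ex_derive_continuous (fun x => / (2 * sin (x / 2)))); auto_derive.
    change (x * / 2) with (x / 2); lra. }
  exists (asin s), (1 / 2 + K); rewrite Hsin.
  split; [exact Hth0|]; split; [lra|]; split; [exact Hsr|].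
  intros th N Hth.
  destruct (RInt_sum_n (fun k y => cos (INR (S k) * r * sin y)) th (PI / 2) N) as [X E].
  { intros k; apply ex_RInt_continuous_le; [lra | intros; apply continuous_cos_sin]. }
  apply Rle_trans with (Rabs (RInt (fun y => sum_n (fun k => cos (INR (S k) * r * sin y)) N) th (PI / 2))).
  { right; f_equal; symmetry; exact E. }
  apply abs_RInt_le_const; [lra | exact X|]; intros y Hy.
  assert (Hy2 : r * s <= r * sin y <= r).
  { assert (B := SIN_bound y).
    assert (sin (asin s) <= sin y) by (apply sin_incr_1; lra). nra. }
  rewrite (sum_n_ext _ (fun k => cos (INR (S k) * (r * sin y)))) by (intros; f_equal; Rring).
  rewrite dirichlet_kernel_div by (apply sin_half_neq_0 with n; lra).
  apply Rle_trans with (1 := Rabs_triang _ _).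
  apply Rplus_le_compat; [rewrite Rabs_Ropp, Rabs_pos_eq; lra|].
  unfold Rdiv; rewrite Rabs_mult, <- (Rmult_1_l K).
  apply Rmult_le_compat; try apply Rabs_pos; [apply Rabs_le, SIN_bound | now apply HK2].
Qed.

Lemma sum_n_scal_plus (a b d : nat -> R) (c : R) (N : nat) :
  (forall k, a k = c * (b k + d k)) -> sum_n a N = c * (sum_n b N + sum_n d N).
Proof.
  intros H; induction N as [|N IH].
  - rewrite !sum_O; apply H.
  - rewrite !sum_n_RS, IH, H; Rring.
Qed.

Lemma schlomilch_series (n : nat) (r : R) : annulus n r ->
  is_series (fun k => J0 (INR (S k) * r))
    (- (1 / 2) + 1 / r
     + 2 * sum_n_m (fun m => 1 / sqrt (r ^ 2 - 4 * INR m ^ 2 * PI ^ 2)) 1 n).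
Proof.
  unfold annulus; intros Ha; assert (HPI := PI_RGT_0); assert (Hn := pos_INR n).
  assert (Hr : 2 * PI * INR n < r < 2 * PI * (INR n + 1)) by lra.
  assert (Hr0 : 0 < r) by nra.
  destruct (schlomilch_tail n r Hr) as [th0 [K [Hth0 [HK [HX HT]]]]].
  set (s := sum_n_m (fun m => 1 / sqrt (r ^ 2 - 4 * INR m ^ 2 * PI ^ 2)) 1 n).
  apply is_series_eps; intros eps He.
  (* Total error per unit of [h = PI / 2 - th]: the first part comes from the tail integral, the
     second from the head, whose term [- th / 2] becomes [- 1 / 2 + h / PI] after scaling by
     [2 / PI]. *)
  set (c := 2 / PI * K + 1 / PI).
  assert (Hc : 0 < c).
  { unfold c; assert (0 < 1 / PI) by (apply Rdiv_lt_0_compat; lra).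
    assert (0 <= 2 / PI * K) by (apply Rmult_le_pos; [left; apply Rdiv_lt_0_compat|]; lra). lra. }
  set (h := Rmin (PI / 2 - th0) (eps / (2 * c))).
  assert (Hh : 0 < h <= PI / 2 - th0).
  { unfold h; split; [apply Rmin_glb_lt; [lra | apply Rdiv_lt_0_compat; lra] | apply Rmin_l]. }
  assert (Hhc : h * c <= eps / 2).
  { apply Rle_trans with (eps / (2 * c) * c).
    - apply Rmult_le_compat_r; [lra | apply Rmin_r].
    - right; field; lra. }
  set (th := PI / 2 - h).
  assert (Hth : 0 <= th < PI / 2) by (unfold th; lra).
  assert (Hsin : r * sin th0 <= r * sin th < r).
  { assert (S := sin_lt_1_of_lt_PI2 th Hth).
    assert (sin th0 <= sin th) by (apply sin_incr_1; unfold th; lra). nra. }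
  assert (HH := schlomilch_head n r th Hr0 Hth ltac:(lra)); fold s in HH.
  destruct (proj1 (is_series_eps _ _) HH (PI / 2 * (eps / 2))) as [N HN].
  { apply Rmult_lt_0_compat; lra. }
  exists N; intros m Hm; specialize (HN m Hm); specialize (HT th m ltac:(unfold th; lra)).
  set (A := sum_n (fun k => RInt (fun y => cos (INR (S k) * r * sin y)) 0 th) m) in HN.
  set (B := sum_n (fun k => RInt (fun y => cos (INR (S k) * r * sin y)) th (PI / 2)) m) in HT.
  assert (E : sum_n (fun k => J0 (INR (S k) * r)) m = 2 / PI * (A + B)).
  { unfold A, B; clear; assert (HPI := PI_RGT_0).
    assert (E : forall k, J0 (INR (S k) * r) = 2 / PI *
      (RInt (fun y => cos (INR (S k) * r * sin y)) 0 th
       + RInt (fun y => cos (INR (S k) * r * sin y)) th (PI / 2))).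
    { intros k; rewrite J0_integral; unfold bessel_integral; f_equal; symmetry.
      assert (X : forall a b, ex_RInt (fun y => cos (INR (S k) * r * sin y)) a b)
        by (intros; apply ex_RInt_continuous_all; intros; apply continuous_cos_sin).
      exact (RInt_Chasles _ 0 th (PI / 2) (X _ _) (X _ _)). }
    exact (sum_n_scal_plus _ _ _ _ m E). }
  rewrite E.
  replace (2 / PI * (A + B) - (- (1 / 2) + 1 / r + 2 * s)) with
    (2 / PI * (A - (PI * (1 / (2 * r) + s) - th / 2)) + (2 / PI * B + h / PI))
    by (unfold th; field; lra).
  assert (P2 : 0 < 2 / PI) by (apply Rdiv_lt_0_compat; lra).
  apply Rle_lt_trans with (1 := Rabs_triang _ _).
  assert (T1 : Rabs (2 / PI * (A - (PI * (1 / (2 * r) + s) - th / 2))) < eps / 2).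
  { rewrite Rabs_mult, (Rabs_pos_eq (2 / PI)) by lra.
    apply Rlt_le_trans with (2 / PI * (PI / 2 * (eps / 2))).
    - now apply Rmult_lt_compat_l.
    - right; field; lra. }
  assert (T2 : Rabs (2 / PI * B + h / PI) <= h * c).
  { apply Rle_trans with (1 := Rabs_triang _ _).
    rewrite Rabs_mult, (Rabs_pos_eq (2 / PI)) by lra.
    rewrite (Rabs_pos_eq (h / PI)) by (left; apply Rdiv_lt_0_compat; lra).
    replace (h * c) with (2 / PI * ((PI / 2 - th) * K) + h / PI)
      by (unfold c, th; field; lra).
    apply Rplus_le_compat_r, Rmult_le_compat_l; lra. }
  lra.
Qed.

(** * The theta functional equation on the axis *)

(** Scaled so that its value at [2 PI m] is [exp (- m^2 PI^2 / tau)] while its cosine transform at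
    [k] is proportional to [exp (- k^2 tau)]. *)
Definition gauss (tau x : R) : R := exp (- x ^ 2 / (4 * tau)).

Lemma gauss_derivatives (tau x : R) : 0 < tau ->
  is_derive (gauss tau) x (- x / (2 * tau) * gauss tau x) /\
  is_derive (fun x => - x / (2 * tau) * gauss tau x) x
    ((x ^ 2 / (4 * tau ^ 2) - 1 / (2 * tau)) * gauss tau x) /\
  continuous (fun x => (x ^ 2 / (4 * tau ^ 2) - 1 / (2 * tau)) * gauss tau x) x.
Proof.
  intros Ht; unfold gauss; split; [|split].
  - auto_derive; [trivial|].
    change (- (x * (x * 1)) * / (4 * tau)) with (- x ^ 2 / (4 * tau)); field; lra.
  - auto_derive; [trivial|].
    change (- (x * (x * 1)) * / (4 * tau)) with (- x ^ 2 / (4 * tau)); field; lra.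
  - apply (ex_derive_continuous
      (fun x => (x ^ 2 / (4 * tau ^ 2) - 1 / (2 * tau)) * exp (- x ^ 2 / (4 * tau)))).
    auto_derive; trivial.
Qed.

Lemma gauss_pos (tau x : R) : 0 < gauss tau x.
Proof. apply exp_pos. Qed.

Lemma continuous_gauss (tau x : R) : continuous (gauss tau) x.
Proof. apply (ex_derive_continuous (gauss tau)); unfold gauss; auto_derive; trivial. Qed.

Lemma exp_neg_le (y : R) : 0 <= y -> exp (- y) <= / (1 + y).
Proof.
  intros Hy; rewrite exp_Ropp; apply Rinv_le_contravar; [lra|].
  destruct (Req_dec y 0) as [->|H]; [rewrite exp_0; lra|].
  left; apply exp_ineq1; exact H.
Qed.

(** The integral increases with [Y] and is bounded through [exp (- y^2) <= 1 / (1 + y^2)] by an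
    arctangent; [G] is its supremum. *)
Lemma gauss_integral_limit : exists G, 0 <= G /\
  (forall Y, 0 <= Y -> RInt (fun y => exp (- y ^ 2)) 0 Y <= G) /\
  forall eps, 0 < eps -> exists Y0, forall Y, Y0 <= Y ->
    Rabs (RInt (fun y => exp (- y ^ 2)) 0 Y - G) < eps.
Proof.
  set (P := fun Y => RInt (fun y => exp (- y ^ 2)) 0 Y).
  assert (HPI := PI_RGT_0).
  assert (C : forall x, continuous (fun y => exp (- y ^ 2)) x).
  { intros x; apply (ex_derive_continuous (fun y => exp (- y ^ 2))); auto_derive; trivial. }
  assert (Hmono : forall a b, 0 <= a <= b -> P a <= P b).
  { intros a b Hab; unfold P.
    assert (E : RInt (fun y => exp (- y ^ 2)) 0 a + RInt (fun y => exp (- y ^ 2)) a b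
      = RInt (fun y => exp (- y ^ 2)) 0 b)
      by (apply (RInt_Chasles (fun y => exp (- y ^ 2))); now apply ex_RInt_continuous_all).
    rewrite <- E.
    assert (0 <= RInt (fun y => exp (- y ^ 2)) a b); [|lra].
    apply RInt_ge_0; [lra | now apply ex_RInt_continuous_all|]; intros; left; apply exp_pos. }
  assert (P0 : P 0 = 0) by exact (RInt_point 0 (fun y => exp (- y ^ 2))).
  assert (Hbound : forall Y, 0 <= Y -> P Y <= PI / 2).
  { intros Y HY.
    assert (E : RInt (fun y => / (1 + y ^ 2)) 0 Y = atan Y - atan 0).
    { apply (RInt_is_derive atan); [exact HY| |].
      - intros x _; apply is_derive_Reals.
        exact (derivable_pt_lim_atan x).
      - intros x _; apply (ex_derive_continuous (fun y => / (1 + y ^ 2))); auto_derive.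
        nra. }
    rewrite atan_0, Rminus_0_r in E.
    apply Rle_trans with (RInt (fun y => / (1 + y ^ 2)) 0 Y).
    - apply RInt_le; [exact HY | now apply ex_RInt_continuous_all | |].
      + apply ex_RInt_continuous_all; intros x.
        apply (ex_derive_continuous (fun y => / (1 + y ^ 2))); auto_derive; nra.
      + intros x _; apply exp_neg_le; nra.
    - rewrite E; left; apply atan_bound. }
  destruct (completeness (fun z => exists Y, 0 <= Y /\ z = P Y)) as [G [HG1 HG2]].
  - exists (PI / 2); intros z [Y [HY ->]]; now apply Hbound.
  - exists (P 0), 0; split; [lra | reflexivity].
  - exists G.
    assert (HG : forall Y, 0 <= Y -> P Y <= G) by (intros Y HY; apply HG1; now exists Y).
    split; [rewrite <- P0; apply HG; lra|]; split; [exact HG|].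
    intros eps He.
    destruct (classic (exists Y, 0 <= Y /\ G - eps < P Y)) as [[Y0 [HY0 H]]|H].
    + exists Y0; intros Y HY.
      assert (A1 := Hmono Y0 Y ltac:(lra)); assert (A2 := HG Y ltac:(lra)).
      fold (P Y); apply Rabs_def1; lra.
    + exfalso; assert (A : G <= G - eps); [|lra].
      apply HG2; intros z [Y [HY ->]]; apply Rnot_lt_le; intros Hlt; apply H; now exists Y.
Qed.

Lemma RInt_gauss_scale (tau X : R) : 0 < tau ->
  RInt (gauss tau) 0 X = 2 * sqrt tau * RInt (fun y => exp (- y ^ 2)) 0 (X / (2 * sqrt tau)).
Proof.
  intros Ht; assert (Hs := sqrt_lt_R0 tau Ht); assert (Hss := sqrt_sqrt tau (Rlt_le _ _ Ht)).
  assert (E := RInt_comp_lin (gauss tau) (2 * sqrt tau) 0 0 (X / (2 * sqrt tau))).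
  replace (2 * sqrt tau * 0 + 0) with 0 in E by ring.
  replace (2 * sqrt tau * (X / (2 * sqrt tau)) + 0) with X in E by (field; lra).
  rewrite <- E by (apply ex_RInt_continuous_all, continuous_gauss).
  rewrite <- RInt_Rscal.
  - apply RInt_ext; intros y _.
    change (2 * sqrt tau * gauss tau (2 * sqrt tau * y + 0) = 2 * sqrt tau * exp (- y ^ 2)).
    unfold gauss.
    replace ((2 * sqrt tau * y + 0) ^ 2) with (4 * (sqrt tau * sqrt tau) * y ^ 2) by ring.
    rewrite Hss; do 2 f_equal; field; lra.
  - apply ex_RInt_continuous_all; intros x.
    apply (ex_derive_continuous (fun y => exp (- y ^ 2))); auto_derive; trivial.
Qed.

(* Writing [phi c] for the cosine integral, [phi c * exp (tau c^2)] has [c]-derivative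
   [2 tau gauss(X) sin (c X) exp (tau c^2)], so it is nearly constant for large [X]. *)
Lemma RInt_gauss_cos (tau X c : R) : 0 < tau -> 0 <= X -> 0 <= c ->
  Rabs (RInt (fun x => gauss tau x * cos (c * x)) 0 X - exp (- c ^ 2 * tau) * RInt (gauss tau) 0 X)
  <= 2 * tau * c * gauss tau X.
Proof.
  intros Ht HX Hc.
  set (phi := fun c => RInt (fun x => gauss tau x * cos (c * x)) 0 X).
  assert (Cgc : forall c x, continuous (fun x => gauss tau x * cos (c * x)) x)
    by (intros; apply continuous_Rmult; [apply continuous_gauss | apply continuous_cos_lin]).
  assert (D : forall u, is_derive phi u (2 * tau * gauss tau X * sin (u * X) - 2 * tau * u * phi u)).
  { intros u.
    assert (E : RInt (fun x => gauss tau x * (- x * sin (u * x))) 0 X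
      = 2 * tau * gauss tau X * sin (u * X) - 2 * tau * u * phi u).
    { assert (E := RInt_is_derive (fun x => 2 * tau * gauss tau x * sin (u * x))
        (fun x => gauss tau x * (- x * sin (u * x)) + 2 * tau * u * (gauss tau x * cos (u * x)))
        0 X HX).
      rewrite RInt_Rplus, RInt_Rscal in E.
      - fold (phi u) in E; apply Rplus_eq_reg_r with (2 * tau * u * phi u); rewrite E.
        + rewrite Rmult_0_r, sin_0; ring.
        + intros x _; unfold gauss; auto_derive; [trivial|].
          change (- (x * (x * 1)) * / (4 * tau)) with (- x ^ 2 / (4 * tau)); field; lra.
        + intros x _; apply (ex_derive_continuous
            (fun x => gauss tau x * (- x * sin (u * x)) + 2 * tau * u * (gauss tau x * cos (u * x)))).
          unfold gauss; auto_derive; trivial.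
      - now apply ex_RInt_continuous_all.
      - apply ex_RInt_continuous_all; intros x.
        apply (ex_derive_continuous (fun x => gauss tau x * (- x * sin (u * x)))).
        unfold gauss; auto_derive; trivial.
      - apply ex_RInt_continuous_all; intros x; apply continuous_Rmult;
          [apply continuous_const | apply Cgc]. }
    rewrite <- E.
    apply (is_derive_RInt_cont (fun u x => gauss tau x * cos (u * x))
      (fun u x => gauss tau x * (- x * sin (u * x)))); [exact HX| |exact Cgc|].
    - intros v t; auto_derive; [trivial | ring].
    - intros t; apply continuity_2d_pt_mult.
      + apply (continuity_1d_2d_pt_comp (gauss tau)); [|apply continuity_2d_pt_id2].
        apply continuity_pt_filterlim, continuous_gauss.
      + apply continuity_2d_pt_mult; [apply continuity_2d_pt_opp, continuity_2d_pt_id2|].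
        apply (continuity_1d_2d_pt_comp sin); [apply continuity_sin|].
        apply continuity_2d_pt_mult; [apply continuity_2d_pt_id1 | apply continuity_2d_pt_id2]. }
  assert (Hpsi : Rabs (phi c * exp (tau * c ^ 2) - phi 0 * exp (tau * 0 ^ 2))
    <= 2 * tau * gauss tau X * exp (tau * c ^ 2) * Rabs (c - 0)).
  { apply (MVT_bound (fun u => phi u * exp (tau * u ^ 2))
      (fun u => 2 * tau * gauss tau X * sin (u * X) * exp (tau * u ^ 2))).
    - intros u _; assert (Du := D u); auto_derive.
      + eexists; exact Du.
      + replace (Derive (fun x => phi x) u) with
          (2 * tau * gauss tau X * sin (u * X) - 2 * tau * u * phi u)
          by (symmetry; exact (is_derive_unique phi u _ Du)).
        change (u * (u * 1)) with (u ^ 2); ring.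
    - intros u; rewrite Rmin_left, Rmax_right by exact Hc; intros Hu.
      assert (G := gauss_pos tau X); assert (E := exp_pos (tau * u ^ 2)).
      rewrite !Rabs_mult, (Rabs_pos_eq 2), (Rabs_pos_eq tau), (Rabs_pos_eq (gauss tau X)),
        (Rabs_pos_eq (exp _)) by lra.
      apply Rmult_le_compat; try lra.
      + apply Rmult_le_pos; [nra | apply Rabs_pos].
      + rewrite <- Rmult_1_r; apply Rmult_le_compat_l; [nra|]; apply Rabs_le, SIN_bound.
      + assert (tau * u ^ 2 <= tau * c ^ 2) by (apply Rmult_le_compat_l; nra).
        destruct (Req_dec (tau * u ^ 2) (tau * c ^ 2)) as [->|]; [lra|].
        left; apply exp_increasing; lra. }
  assert (P0 : phi 0 = RInt (gauss tau) 0 X).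
  { apply RInt_ext; intros x _; rewrite Rmult_0_l, cos_0; apply Rmult_1_r. }
  rewrite P0 in Hpsi; fold (phi c).
  replace (tau * 0 ^ 2) with 0 in Hpsi by ring.
  rewrite exp_0, Rmult_1_r, Rminus_0_r, (Rabs_pos_eq c) in Hpsi by exact Hc.
  set (w := exp (- c ^ 2 * tau)).
  assert (Hw : 0 < w) by apply exp_pos.
  assert (Hww : exp (tau * c ^ 2) * w = 1).
  { unfold w; rewrite <- exp_plus, <- exp_0; f_equal; ring. }
  replace (phi c - w * RInt (gauss tau) 0 X) with
    (w * (phi c * exp (tau * c ^ 2) - RInt (gauss tau) 0 X)).
  - rewrite Rabs_mult, (Rabs_pos_eq w) by lra.
    apply Rle_trans with (w * (2 * tau * gauss tau X * exp (tau * c ^ 2) * c)).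
    + apply Rmult_le_compat_l; lra.
    + right; replace (w * (2 * tau * gauss tau X * exp (tau * c ^ 2) * c)) with
        (2 * tau * gauss tau X * c * (exp (tau * c ^ 2) * w)) by ring.
      rewrite Hww; ring.
  - transitivity (phi c * (exp (tau * c ^ 2) * w) - w * RInt (gauss tau) 0 X); [ring|].
    rewrite Hww; ring.
Qed.

(** Provides the summable majorant for letting [X] grow. The condition on [sin (c X)] removes the
    boundary term of order [1 / c], leaving a boundary term and an integral, both of order
    [1 / c^2]; each contributes [1 / tau] to the constant. *)
Lemma RInt_gauss_cos_dom (tau X c : R) : 0 < tau -> 0 <= X -> 0 < c -> sin (c * X) = 0 ->
  Rabs (RInt (fun x => gauss tau x * cos (c * x)) 0 X)
  <= 2 / tau * RInt (gauss tau) 0 X * (1 / c ^ 2).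
Proof.
  intros Ht HX Hc Hsin.
  set (g2 := fun x => (x ^ 2 / (4 * tau ^ 2) - 1 / (2 * tau)) * gauss tau x).
  assert (Cg2 : forall x, continuous g2 x) by (intros x; apply (gauss_derivatives tau x Ht)).
  assert (CA : forall x, continuous (fun x => Rabs (g2 x)) x)
    by (intros x; apply (continuous_comp g2 Rabs); [apply Cg2 | apply continuous_Rabs]).
  assert (E1 : RInt g2 0 X = - X / (2 * tau) * gauss tau X).
  { rewrite (RInt_is_derive (fun x => - x / (2 * tau) * gauss tau x) g2 0 X HX).
    - Rfield; lra.
    - intros x _; apply (gauss_derivatives tau x Ht).
    - intros; apply Cg2. }
  assert (Hc2 : 0 < c ^ 2) by nra.
  (* Only the part [- gauss / (2 tau)] of [g2] is negative, so [|g2| <= g2 + gauss / tau]; moreover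
     the integral of [g2] is not positive. *)
  assert (EA : RInt (fun x => Rabs (g2 x)) 0 X <= 1 / tau * RInt (gauss tau) 0 X).
  { apply Rle_trans with (RInt (fun x => g2 x + 1 / tau * gauss tau x) 0 X).
    - apply RInt_le; [exact HX | now apply ex_RInt_continuous_all | |].
      + apply ex_RInt_continuous_all; intros x; apply continuous_Rplus; [apply Cg2|].
        apply continuous_Rmult; [apply continuous_const | apply continuous_gauss].
      + intros x _; unfold g2; assert (G := gauss_pos tau x).
        assert (A : 0 <= x ^ 2 / (4 * tau ^ 2)).
        { apply Rmult_le_pos; [nra | left; apply Rinv_0_lt_compat; nra]. }
        assert (B : 0 < 1 / (2 * tau)) by (apply Rdiv_lt_0_compat; lra).
        assert (B2 : 1 / tau = 2 * (1 / (2 * tau))) by (field; lra).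
        rewrite B2, Rabs_mult, (Rabs_pos_eq (gauss tau x)) by lra.
        rewrite <- Rmult_plus_distr_r; apply Rmult_le_compat_r; [lra|].
        apply Rabs_le; lra.
    - rewrite RInt_Rplus, RInt_Rscal, E1.
      + assert (G := gauss_pos tau X).
        assert (0 <= X / (2 * tau)) by (apply Rmult_le_pos; [lra | left; apply Rinv_0_lt_compat; lra]).
        replace (- X / (2 * tau)) with (- (X / (2 * tau))) by (field; lra); nra.
      + apply ex_RInt_continuous_all, continuous_gauss.
      + now apply ex_RInt_continuous_all.
      + apply ex_RInt_continuous_all; intros x.
        apply continuous_Rmult; [apply continuous_const | apply continuous_gauss]. }
  assert (EB : Rabs (- X / (2 * tau) * gauss tau X) <= 1 / tau * RInt (gauss tau) 0 X).
  { rewrite <- E1; apply Rle_trans with (2 := EA).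
    apply abs_RInt_le; [exact HX | now apply ex_RInt_continuous_all]. }
  rewrite (RInt_cos_parts (gauss tau) (fun x => - x / (2 * tau) * gauss tau x) g2 0 X c HX)
    by (lra || (intros x _; apply (gauss_derivatives tau x Ht)) || (intros; apply Cg2)).
  rewrite Hsin, !Rmult_0_r, sin_0.
  assert (Cc : forall x, continuous (fun x => g2 x * (cos (c * x) / c ^ 2)) x).
  { intros x; apply continuous_Rmult; [apply Cg2|].
    apply (ex_derive_continuous (fun x => cos (c * x) / c ^ 2)); auto_derive; trivial. }
  assert (EI : Rabs (RInt (fun x => g2 x * (cos (c * x) / c ^ 2)) 0 X)
    <= 1 / tau * RInt (gauss tau) 0 X * (1 / c ^ 2)).
  { apply Rle_trans with (RInt (fun x => 1 / c ^ 2 * Rabs (g2 x)) 0 X).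
    - apply Rle_trans with (RInt (fun x => Rabs (g2 x * (cos (c * x) / c ^ 2))) 0 X).
      { apply abs_RInt_le; [exact HX | now apply ex_RInt_continuous_all]. }
      apply RInt_le; [exact HX| | |].
      + apply ex_RInt_continuous_all; intros x.
        apply (continuous_comp (fun x => g2 x * (cos (c * x) / c ^ 2)) Rabs);
          [apply Cc | apply continuous_Rabs].
      + apply ex_RInt_continuous_all; intros x; apply continuous_Rmult;
          [apply continuous_const | apply CA].
      + intros x _; rewrite Rabs_mult, Rmult_comm; apply Rmult_le_compat_r; [apply Rabs_pos|].
        unfold Rdiv; rewrite Rabs_mult, (Rabs_pos_eq (/ c ^ 2))
          by (left; now apply Rinv_0_lt_compat).
        apply Rmult_le_compat_r; [left; now apply Rinv_0_lt_compat|].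
        apply Rabs_le, COS_bound.
    - rewrite RInt_Rscal by now apply ex_RInt_continuous_all.
      rewrite Rmult_comm; apply Rmult_le_compat_r; [|exact EA].
      left; apply Rdiv_lt_0_compat; lra. }
  assert (EJ : Rabs (- X / (2 * tau) * gauss tau X * cos (c * X) / c ^ 2)
    <= 1 / tau * RInt (gauss tau) 0 X * (1 / c ^ 2)).
  { unfold Rdiv at 1; rewrite Rabs_mult, (Rabs_pos_eq (/ c ^ 2)) by (left; now apply Rinv_0_lt_compat).
    replace (1 / c ^ 2) with (/ c ^ 2) by (field; lra).
    apply Rmult_le_compat_r; [left; now apply Rinv_0_lt_compat|].
    rewrite Rabs_mult, <- (Rmult_1_r (1 / tau * _)).
    apply Rmult_le_compat; try apply Rabs_pos; [exact EB | apply Rabs_le, COS_bound]. }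
  set (u := - X / (2 * tau) * gauss tau X * cos (c * X) / c ^ 2) in *.
  set (v := RInt (fun x => g2 x * (cos (c * x) / c ^ 2)) 0 X) in *.
  match goal with |- Rabs ?z <= _ => replace z with (u - v) by (unfold u; field; lra) end.
  replace (2 / tau * RInt (gauss tau) 0 X * (1 / c ^ 2)) with
    (1 / tau * RInt (gauss tau) 0 X * (1 / c ^ 2) + 1 / tau * RInt (gauss tau) 0 X * (1 / c ^ 2))
    by (field; lra).
  apply Rle_trans with (1 := Rabs_triang _ _); rewrite Rabs_Ropp; lra.
Qed.

(** [1 / 2 + theta_tail tau] is half the Jacobi theta series, the sum of [exp (- k^2 tau)] over all
    integers [k]. *)
Definition theta_tail (tau : R) : R := Series (fun k => exp (- INR (S k) ^ 2 * tau)).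

Lemma exp_neg_sqr_le_geom (tau : R) (k : nat) : 0 < tau ->
  exp (- INR (S k) ^ 2 * tau) <= exp (- tau) ^ k.
Proof.
  intros Ht; assert (E : exp (- tau) ^ k = exp (- tau * INR k)).
  { induction k as [|k IH]; [simpl; now rewrite Rmult_0_r, exp_0|].
    rewrite S_INR; simpl pow; rewrite IH, <- exp_plus; f_equal; ring. }
  rewrite E; left; apply exp_increasing; rewrite S_INR; assert (H := pos_INR k); nra.
Qed.

Lemma ex_series_geom_exp (tau : R) : 0 < tau -> ex_series (fun k => exp (- tau) ^ k).
Proof.
  intros Ht; apply ex_series_geom.
  rewrite Rabs_pos_eq by (left; apply exp_pos).
  rewrite <- exp_0; apply exp_increasing; lra.
Qed.

Lemma ex_series_theta (tau : R) : 0 < tau -> ex_series (fun k => exp (- INR (S k) ^ 2 * tau)).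
Proof.
  intros Ht; apply ex_series_dom with (2 := ex_series_geom_exp tau Ht); intros k.
  rewrite Rabs_pos_eq by (left; apply exp_pos); now apply exp_neg_sqr_le_geom.
Qed.

Lemma filterlim_Rplus {T : Type} (F : (T -> Prop) -> Prop) {FF : Filter F} (f g : T -> R) (a b : R) :
  filterlim f F (locally a) -> filterlim g F (locally b) ->
  filterlim (fun x => f x + g x) F (locally (a + b)).
Proof.
  intros Hf Hg; apply (filterlim_comp_2 (G := locally a) (H := locally b) _ _ Rplus Hf Hg).
  exact (filterlim_plus a b).
Qed.

Lemma filterlim_Rscal {T : Type} (F : (T -> Prop) -> Prop) {FF : Filter F} (f : T -> R) (c a : R) :
  filterlim f F (locally a) -> filterlim (fun x => c * f x) F (locally (c * a)).
Proof.
  intros Hf; apply (filterlim_comp _ _ _ _ (fun y => c * y) _ _ _ Hf).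
  apply (ex_derive_continuous (fun y => c * y) a); auto_derive; trivial.
Qed.

(** The limit of the sums of cosine integrals over [[0, X n]] is computed twice: termwise by
    [tannery], and by [poisson_finite] for each [n]. Uniqueness of limits gives the identity. *)
Lemma theta_poisson_constant : exists G, forall tau, 0 < tau ->
  2 * sqrt tau * G * (1 / 2 + theta_tail tau) = PI * (1 / 2 + theta_tail (PI ^ 2 / tau)).
Proof.
  assert (HPI := PI_RGT_0).
  destruct gauss_integral_limit as [G [HG0 [HG1 HG2]]]; exists G; intros tau Ht.
  assert (Hs := sqrt_lt_R0 tau Ht).
  (* An odd multiple of [PI]: it lies strictly between consecutive multiples of [2 PI], and
     [sin (k X)] vanishes for every integer [k]. *)
  set (X := fun n : nat => 2 * PI * INR (S n) + PI).
  assert (HX : forall n, INR n <= X n).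
  { intros n; unfold X; rewrite S_INR; assert (H := pos_INR n); assert (P := PI2_1); nra. }
  assert (HX0 : forall n, 0 <= X n) by (intros n; specialize (HX n); generalize (pos_INR n); lra).
  assert (LG : filterlim (fun n => RInt (gauss tau) 0 (X n)) eventually (locally (2 * sqrt tau * G))).
  { apply filterlim_ext with
      (fun n => 2 * sqrt tau * RInt (fun y => exp (- y ^ 2)) 0 (X n / (2 * sqrt tau))).
    { intros n; symmetry; now apply RInt_gauss_scale. }
    apply filterlim_Rscal; [typeclasses eauto|]; apply filterlim_eps; [typeclasses eauto|]; intros eps He.
    destruct (HG2 eps He) as [Y0 HY0].
    destruct (nfloor_ex (Rabs (Y0 * (2 * sqrt tau)))) as [N HN]; [apply Rabs_pos|].
    exists (S N); intros n Hn; apply HY0.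
    apply le_INR in Hn; rewrite S_INR in Hn; specialize (HX n).
    apply Rmult_le_reg_r with (2 * sqrt tau); [lra|].
    replace (X n / (2 * sqrt tau) * (2 * sqrt tau)) with (X n) by (field; lra).
    generalize (Rle_abs (Y0 * (2 * sqrt tau))); lra. }
  assert (HB : forall n, RInt (gauss tau) 0 (X n) <= 2 * sqrt tau * G).
  { intros n; rewrite RInt_gauss_scale by exact Ht.
    apply Rmult_le_compat_l; [lra|]; apply HG1.
    apply Rmult_le_pos; [apply HX0 | left; apply Rinv_0_lt_compat; lra]. }
  assert (L1 : filterlim (fun n => Series (fun k => RInt (fun x => gauss tau x * cos (INR (S k) * x)) 0 (X n)))
    eventually (locally (Series (fun k => exp (- INR (S k) ^ 2 * tau) * (2 * sqrt tau * G))))).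
  { apply (tannery eventually
      (fun k n => RInt (fun x => gauss tau x * cos (INR (S k) * x)) 0 (X n))
      (fun k => exp (- INR (S k) ^ 2 * tau) * (2 * sqrt tau * G))
      (fun k => 2 / tau * (2 * sqrt tau * G) * (1 / INR (S k) ^ 2))).
    - destruct ex_series_inv_sqr as [l Hl]; eexists; apply is_series_Rscal, Hl.
    - exists 0%nat; intros n _ k.
      assert (P := INR_S_pos k); assert (P2 : 0 < INR (S k) ^ 2) by nra.
      apply Rle_trans with (2 / tau * RInt (gauss tau) 0 (X n) * (1 / INR (S k) ^ 2)).
      + apply RInt_gauss_cos_dom; [exact Ht | apply HX0 | exact P|].
        replace (INR (S k) * X n) with (INR (S k * (2 * S n + 1)) * PI).
        * apply sin_INR_PI.
        * unfold X; rewrite mult_INR, plus_INR, (mult_INR 2); simpl (INR 2); simpl (INR 1); ring.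
      + apply Rmult_le_compat_r; [left; apply Rdiv_lt_0_compat; lra|].
        apply Rmult_le_compat_l; [left; apply Rdiv_lt_0_compat; lra | apply HB].
    - intros k; set (c := INR (S k)).
      assert (P : 0 < c) by apply INR_S_pos.
      apply filterlim_ext with (fun n =>
        exp (- c ^ 2 * tau) * RInt (gauss tau) 0 (X n) +
        (RInt (fun x => gauss tau x * cos (c * x)) 0 (X n)
         - exp (- c ^ 2 * tau) * RInt (gauss tau) 0 (X n))); [intros n; ring|].
      rewrite <- (Rplus_0_r (exp (- c ^ 2 * tau) * _)).
      apply filterlim_Rplus; [typeclasses eauto | now apply filterlim_Rscal; [typeclasses eauto|]|].
      apply filterlim_eps; [typeclasses eauto|]; intros eps He.
      (* The error of [RInt_gauss_cos] is [2 tau c * gauss (X n)], and [exp (- y) <= 1 / (1 + y)] at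
         [y = X^2 / (4 tau)] with [X^2 >= n + 1] gives [gauss (X n) <= 4 tau / (n + 1)]. *)
      destruct (eventually_div_INR_lt (2 * tau * c * (4 * tau)) eps) as [N HN]; [|exact He|].
      { assert (0 < tau * c) by nra; assert (0 < tau * c * tau) by nra; lra. }
      exists (S N); intros n Hn; rewrite Rminus_0_r.
      apply Rle_lt_trans with (1 := RInt_gauss_cos tau (X n) c Ht (HX0 n) (Rlt_le _ _ P)).
      apply Rle_lt_trans with (2 := HN n ltac:(lia)).
      assert (Hn0 := pos_INR n).
      replace (2 * tau * c * (4 * tau) / (INR n + 1)) with
        (2 * tau * c * (4 * tau * / (INR n + 1))) by (field; lra).
      apply Rmult_le_compat_l; [nra|].
      unfold gauss; replace (- X n ^ 2 / (4 * tau)) with (- (X n ^ 2 / (4 * tau))) by (field; lra).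
      assert (HX2 : INR n + 1 <= X n ^ 2).
      { assert (INR n + 1 <= X n) by (unfold X; rewrite S_INR; assert (Q := PI2_1); nra). nra. }
      apply Rle_trans with (/ (1 + X n ^ 2 / (4 * tau))).
      + apply exp_neg_le, Rmult_le_pos; [nra | left; apply Rinv_0_lt_compat; lra].
      + replace (/ (1 + X n ^ 2 / (4 * tau))) with (4 * tau * / (4 * tau + X n ^ 2))
          by (field; nra).
        apply Rmult_le_compat_l; [lra|]; apply Rinv_le_contravar; lra. }
  assert (L2 : filterlim (fun n => Series (fun k => RInt (fun x => gauss tau x * cos (INR (S k) * x)) 0 (X n)))
    eventually (locally (PI * (1 / 2 + theta_tail (PI ^ 2 / tau)) + - (1 / 2) * (2 * sqrt tau * G)))).
  { assert (Ht2 : 0 < PI ^ 2 / tau) by (apply Rdiv_lt_0_compat; nra).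
    apply filterlim_ext with (fun n =>
      PI * (1 / 2 + sum_n (fun k => exp (- INR (S k) ^ 2 * (PI ^ 2 / tau))) n)
      + - (1 / 2) * RInt (gauss tau) 0 (X n)).
    - intros n; symmetry; apply is_series_unique.
      assert (H := poisson_finite (S n) (gauss tau) (fun x => - x / (2 * tau) * gauss tau x)
        (fun x => (x ^ 2 / (4 * tau ^ 2) - 1 / (2 * tau)) * gauss tau x) (X n)
        ltac:(unfold X; lra)
        (fun x _ => proj1 (gauss_derivatives tau x Ht))
        (fun x _ => proj1 (proj2 (gauss_derivatives tau x Ht)))
        (fun x _ => proj2 (proj2 (gauss_derivatives tau x Ht)))).
      assert (G0 : gauss tau 0 = 1).
      { unfold gauss; rewrite <- exp_0; f_equal; field; lra. }
      rewrite G0 in H.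
      assert (ES : sum_n_m (fun m => gauss tau (2 * PI * INR m)) 1 (S n)
        = sum_n (fun k => exp (- INR (S k) ^ 2 * (PI ^ 2 / tau))) n).
      { rewrite <- (sum_n_m_S (fun m => gauss tau (2 * PI * INR m))).
        apply sum_n_m_ext; intros k; unfold gauss; f_equal; field; lra. }
      rewrite ES in H.
      match goal with |- is_series _ ?l => match type of H with is_series _ ?l' =>
        replace l with l' by field; exact H end end.
    - apply filterlim_Rplus; [typeclasses eauto| |apply filterlim_Rscal; [typeclasses eauto | exact LG]].
      apply filterlim_Rscal; [typeclasses eauto|].
      apply filterlim_Rplus; [typeclasses eauto | apply filterlim_const|].
      exact (Series_correct _ (ex_series_theta _ Ht2)). }
  assert (E : Series (fun k => exp (- INR (S k) ^ 2 * tau) * (2 * sqrt tau * G)) =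
    PI * (1 / 2 + theta_tail (PI ^ 2 / tau)) + - (1 / 2) * (2 * sqrt tau * G))
    by exact (filterlim_locally_unique _ _ _ L1 L2).
  rewrite Series_scal_r in E; fold (theta_tail tau) in E; lra.
Qed.

(* The constant in [theta_poisson_constant] is forced by the fixed point [tau = PI]. *)
Lemma theta_functional_equation (tau : R) : 0 < tau ->
  1 / 2 + theta_tail tau = sqrt (PI / tau) * (1 / 2 + theta_tail (PI ^ 2 / tau)).
Proof.
  intros Ht; assert (HPI := PI_RGT_0).
  destruct theta_poisson_constant as [G HG].
  assert (HP := HG PI HPI).
  replace (PI ^ 2 / PI) with PI in HP by (field; lra).
  (* Positivity permits cancelling [1 / 2 + theta_tail PI] at the fixed point, which leaves
     [2 sqrt PI * G = PI], that is [2 G = sqrt PI]. *)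
  assert (Pos : 0 <= theta_tail PI).
  { apply Rnot_lt_le; intros Hneg.
    destruct (proj1 (is_series_eps _ _) (Series_correct _ (ex_series_theta PI HPI)) (- theta_tail PI))
      as [N HN]; [lra|].
    specialize (HN N (le_n _)); fold (theta_tail PI) in HN; apply Rabs_def2 in HN.
    assert (0 <= sum_n (fun k => exp (- INR (S k) ^ 2 * PI)) N); [|lra].
    clear; induction N as [|N IH]; [rewrite sum_O; left; apply exp_pos|].
    rewrite sum_n_RS; generalize (exp_pos (- INR (S (S N)) ^ 2 * PI)); lra. }
  assert (HG2 : 2 * sqrt PI * G = PI) by (apply Rmult_eq_reg_r with (1 / 2 + theta_tail PI); lra).
  assert (S1 := sqrt_lt_R0 PI HPI); assert (S2 := sqrt_lt_R0 tau Ht).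
  assert (SS := sqrt_sqrt PI (Rlt_le _ _ HPI)).
  assert (HG3 : 2 * G = sqrt PI).
  { apply Rmult_eq_reg_l with (sqrt PI); [|lra]; lra. }
  assert (H := HG tau Ht).
  rewrite sqrt_div by lra.
  apply Rmult_eq_reg_l with (sqrt tau * sqrt PI); [|nra].
  transitivity (2 * sqrt tau * G * (1 / 2 + theta_tail tau)); [rewrite <- HG3; ring|].
  rewrite H, <- SS at 1; field; lra.
Qed.

(** * The heat equation *)

Lemma is_derive_J0 (z : R) : is_derive J0 z (bessel_integral1 z).
Proof.
  apply is_derive_ext with bessel_integral; [|apply is_derive_bessel_integral].
  intros t; symmetry; apply J0_integral.
Qed.

Lemma J0_0 : J0 0 = 1.
Proof.
  assert (HPI := PI_RGT_0).
  rewrite J0_integral; unfold bessel_integral.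
  rewrite (RInt_ext _ (fun _ => 1)) by (intros; now rewrite Rmult_0_l, cos_0).
  rewrite RInt_const; change (scal ?a ?b) with (a * b); Rfield; lra.
Qed.

Lemma ex_series_mul_geom (q : R) : 0 < q < 1 -> ex_series (fun k => (INR k + 1) ^ 2 * q ^ k).
Proof.
  intros Hq.
  (* With [t] the fourth root of [q], half of [q^k = t^(4k)] absorbs [(k + 1)^2], since
     [(k + 1) t^k] is bounded; the other half, [s^k], is geometric. *)
  set (s := sqrt q).
  assert (Hs : s * s = q) by (apply sqrt_sqrt; lra).
  assert (Hs0 : 0 < s) by (apply sqrt_lt_R0; lra).
  assert (Hs1 : s < 1) by nra.
  set (t := sqrt s).
  assert (Ht : t * t = s) by (apply sqrt_sqrt; lra).
  assert (Ht0 : 0 < t) by (apply sqrt_lt_R0; lra).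
  assert (Ht1 : t < 1) by nra.
  (* Bernoulli: (k + 1) t^k is bounded, because (1 + (1/t - 1))^k >= 1 + k (1/t - 1). *)
  assert (B : forall k : nat, (INR k + 1) * (1 - t) * t ^ k <= 1).
  { assert (B : forall k : nat, (1 + INR k * (1 - t)) * t ^ k <= 1).
    { induction k as [|k IH]; [simpl; lra|].
      rewrite S_INR; simpl pow; assert (P := pow_lt t k Ht0); assert (Q := pos_INR k).
      apply Rle_trans with (2 := IH).
      assert (0 <= (1 + INR k * (1 - t)) - (1 + (INR k + 1) * (1 - t)) * t); [|nra].
      assert (0 <= INR k * ((1 - t) * (1 - t))) by (apply Rmult_le_pos; nra); nra. }
    intros k; apply Rle_trans with (2 := B k); apply Rmult_le_compat_r; [|lra].
    left; now apply pow_lt. }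
  apply ex_series_dom with (fun k => / (1 - t) ^ 2 * s ^ k).
  - intros k; assert (P := pow_lt t k Ht0); assert (Q := pos_INR k); specialize (B k).
    assert (P1 := pow_lt s k Hs0).
    rewrite Rabs_pos_eq by (apply Rmult_le_pos; [nra | left; apply pow_lt; lra]).
    apply Rmult_le_reg_l with ((1 - t) ^ 2); [nra|].
    replace ((1 - t) ^ 2 * (/ (1 - t) ^ 2 * s ^ k)) with (s ^ k) by (field; lra).
    rewrite <- Hs, Rpow_mult_distr.
    replace ((1 - t) ^ 2 * ((INR k + 1) ^ 2 * (s ^ k * s ^ k))) with
      (((INR k + 1) * (1 - t)) ^ 2 * s ^ k * s ^ k) by ring.
    rewrite <- (Rmult_1_l (s ^ k)) at 3; apply Rmult_le_compat_r; [lra|].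
    rewrite <- Ht, (Rpow_mult_distr t).
    replace (((INR k + 1) * (1 - t)) ^ 2 * (t ^ k * t ^ k)) with
      (((INR k + 1) * (1 - t) * t ^ k) * ((INR k + 1) * (1 - t) * t ^ k)) by ring.
    assert (0 <= (INR k + 1) * (1 - t) * t ^ k) by (repeat apply Rmult_le_pos; lra).
    nra.
  - destruct (ex_series_geom s) as [l Hl]; [rewrite Rabs_pos_eq; lra|].
    exists (/ (1 - t) ^ 2 * l); now apply is_series_Rscal.
Qed.

Lemma ex_series_sqr_gauss (a : R) : 0 < a ->
  ex_series (fun k => INR (S k) ^ 2 * exp (- INR (S k) ^ 2 * a)).
Proof.
  intros Ha; apply ex_series_dom with (fun k => (INR k + 1) ^ 2 * exp (- a) ^ k).
  - intros k; rewrite S_INR; rewrite Rabs_pos_eq.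
    + apply Rmult_le_compat_l; [apply pow2_ge_0|].
      rewrite <- S_INR; now apply exp_neg_sqr_le_geom.
    + apply Rmult_le_pos; [apply pow2_ge_0 | left; apply exp_pos].
  - apply ex_series_mul_geom; split; [apply exp_pos|].
    rewrite <- exp_0; apply exp_increasing; lra.
Qed.

Definition decay (kappa t : R) (k : nat) : R := exp (- INR (S k) ^ 2 * kappa * t).

(** A common majorant, independent of [r], for the k-th term and its first two [r]-derivatives: each
    differentiation costs one factor [k + 1]. *)
Definition decay2 (kappa t : R) (k : nat) : R := INR (S k) ^ 2 * decay kappa t k.

Lemma INR_S_ge_1 (k : nat) : 1 <= INR (S k).
Proof. rewrite S_INR; generalize (pos_INR k); lra. Qed.

Lemma ex_series_decay2 (kappa t : R) : 0 < kappa -> 0 < t -> ex_series (decay2 kappa t).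
Proof.
  intros Hk Ht; apply ex_series_ext with (2 := ex_series_sqr_gauss (kappa * t) ltac:(nra)).
  intros k; unfold decay2, decay; now rewrite Rmult_assoc.
Qed.

Lemma decay2_bound (kappa t f c : R) (k : nat) :
  Rabs f <= 1 -> 0 <= c <= INR (S k) ^ 2 -> Rabs (c * f * decay kappa t k) <= decay2 kappa t k.
Proof.
  intros Hf Hc; unfold decay2; assert (P : 0 < decay kappa t k) by apply exp_pos.
  rewrite Rabs_mult, Rabs_mult, (Rabs_pos_eq c), (Rabs_pos_eq (decay kappa t k)) by lra.
  apply Rmult_le_compat_r; [lra|].
  assert (A := Rabs_pos f); nra.
Qed.

Definition heat_term_r (kappa t r : R) (k : nat) : R :=
  INR (S k) * bessel_integral1 (INR (S k) * r) * decay kappa t k.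
Definition heat_term_rr (kappa t r : R) (k : nat) : R :=
  INR (S k) ^ 2 * bessel_integral2 (INR (S k) * r) * decay kappa t k.

Lemma heat_term_bound (kappa t r : R) (k : nat) : Rabs (heat_term kappa r t k) <= decay2 kappa t k.
Proof.
  unfold heat_term; fold (decay kappa t k); rewrite <- (Rmult_1_l (J0 _)).
  apply decay2_bound; [rewrite J0_integral; apply bessel_integral_bound|].
  generalize (INR_S_ge_1 k); nra.
Qed.

Lemma heat_term_r_bound (kappa t r : R) (k : nat) : Rabs (heat_term_r kappa t r k) <= decay2 kappa t k.
Proof.
  apply decay2_bound; [apply bessel_integral1_bound|]; generalize (INR_S_ge_1 k); nra.
Qed.

Lemma heat_term_rr_bound (kappa t r : R) (k : nat) : Rabs (heat_term_rr kappa t r k) <= decay2 kappa t k.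
Proof.
  apply decay2_bound; [apply bessel_integral2_bound|]; generalize (INR_S_ge_1 k); nra.
Qed.

Lemma ex_series_heat_term (kappa t r : R) : 0 < kappa -> 0 < t -> ex_series (heat_term kappa r t).
Proof.
  intros Hk Ht.
  exact (ex_series_dom _ _ (heat_term_bound kappa t r) (ex_series_decay2 kappa t Hk Ht)).
Qed.

(** Valid at every real [r]; at [r = 0] it also yields continuity up to the axis. *)
Lemma is_derive_heat_r (kappa t r : R) : 0 < kappa -> 0 < t ->
  is_derive (fun x => bessel_heat kappa x t) r (Series (heat_term_r kappa t r)).
Proof.
  intros Hk Ht.
  apply (is_derive_Series (fun k x => heat_term kappa x t k) (fun k x => heat_term_r kappa t x k)
    (decay2 kappa t) r (mkposreal 1 Rlt_0_1) (ex_series_decay2 kappa t Hk Ht)).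
  - intros y _; now apply ex_series_heat_term.
  - intros k y _; unfold heat_term, heat_term_r; fold (decay kappa t k).
    assert (D := is_derive_J0 (INR (S k) * y)).
    assert (D2 : is_derive (fun x => J0 (INR (S k) * x)) y
      (INR (S k) * bessel_integral1 (INR (S k) * y))).
    { apply (is_derive_comp J0 (fun x => INR (S k) * x)); [exact D|].
      generalize (INR (S k)); intros c; auto_derive; [trivial | ring]. }
    apply is_derive_ext with (fun x => decay kappa t k * J0 (INR (S k) * x)); [intros x; Rring|].
    replace (INR (S k) * bessel_integral1 (INR (S k) * y) * decay kappa t k) with
      (decay kappa t k * (INR (S k) * bessel_integral1 (INR (S k) * y))) by ring.
    exact (is_derive_scal _ _ (decay kappa t k) _ D2).
  - intros k y _; apply heat_term_r_bound.
Qed.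

Lemma is_derive_heat_rr (kappa t r : R) : 0 < kappa -> 0 < t ->
  is_derive (fun x => Series (heat_term_r kappa t x)) r (Series (heat_term_rr kappa t r)).
Proof.
  intros Hk Ht.
  apply (is_derive_Series (fun k x => heat_term_r kappa t x k) (fun k x => heat_term_rr kappa t x k)
    (decay2 kappa t) r (mkposreal 1 Rlt_0_1) (ex_series_decay2 kappa t Hk Ht)).
  - intros y _.
    exact (ex_series_dom _ _ (heat_term_r_bound kappa t y) (ex_series_decay2 kappa t Hk Ht)).
  - intros k y _; unfold heat_term_r, heat_term_rr.
    assert (D := is_derive_bessel_integral1 (INR (S k) * y)).
    assert (D2 : is_derive (fun x => bessel_integral1 (INR (S k) * x)) y
      (INR (S k) * bessel_integral2 (INR (S k) * y))).
    { apply (is_derive_comp bessel_integral1 (fun x => INR (S k) * x)); [exact D|].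
      generalize (INR (S k)); intros c; auto_derive; [trivial | ring]. }
    apply is_derive_ext with (fun x => INR (S k) * decay kappa t k * bessel_integral1 (INR (S k) * x));
      [intros x; Rring|].
    replace (INR (S k) ^ 2 * bessel_integral2 (INR (S k) * y) * decay kappa t k) with
      (INR (S k) * decay kappa t k * (INR (S k) * bessel_integral2 (INR (S k) * y))) by ring.
    exact (is_derive_scal _ _ (INR (S k) * decay kappa t k) _ D2).
  - intros k y _; apply heat_term_rr_bound.
Qed.

Lemma is_derive_heat_t (kappa r t : R) : 0 < kappa -> 0 < t ->
  is_derive (fun s => bessel_heat kappa r s) t
    (Series (fun k => - kappa * (INR (S k) ^ 2 * heat_term kappa r t k))).
Proof.
  intros Hk Ht; assert (Ht2 : 0 < t / 2) by lra.
  apply (is_derive_Series (fun k s => heat_term kappa r s k)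
    (fun k s => - kappa * (INR (S k) ^ 2 * heat_term kappa r s k))
    (* For [s] within [t / 2] of [t] one has [s > t / 2], so the exponential at time [t / 2]
       dominates on the whole neighbourhood. *)
    (fun k => kappa * (INR (S k) ^ 2 * exp (- INR (S k) ^ 2 * (kappa * (t / 2)))))
    t (mkposreal (t / 2) Ht2)); simpl pos.
  - destruct (ex_series_sqr_gauss (kappa * (t / 2)) ltac:(nra)) as [l Hl].
    eexists; apply is_series_Rscal, Hl.
  - intros s Hs; apply ex_series_heat_term; [exact Hk|]; apply Rabs_def2 in Hs; lra.
  - intros k s _; unfold heat_term.
    generalize (INR (S k)) (J0 (INR (S k) * r)); intros c j; auto_derive; [trivial|].
    simpl; ring.
  - intros k s Hs; apply Rabs_def2 in Hs; unfold heat_term.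
    rewrite !Rabs_mult, Rabs_Ropp, (Rabs_pos_eq kappa), (Rabs_pos_eq (exp _))
      by (try (left; apply exp_pos); lra).
    assert (P : 0 <= INR (S k) ^ 2) by nra.
    rewrite (Rabs_pos_eq (INR (S k) ^ 2)) by exact P.
    apply Rmult_le_compat_l; [lra|]; apply Rmult_le_compat_l; [exact P|].
    rewrite <- (Rmult_1_l (exp (- INR (S k) ^ 2 * (kappa * (t / 2))))).
    apply Rmult_le_compat; [apply Rabs_pos | left; apply exp_pos | |].
    + rewrite J0_integral; apply bessel_integral_bound.
    + left; apply exp_increasing.
      assert (1 <= INR (S k)) by apply INR_S_ge_1.
      assert (0 < INR (S k) ^ 2 * kappa) by (apply Rmult_lt_0_compat; nra). nra.
Qed.

Lemma bessel_heat_equation (kappa : R) (n : nat) : 0 < kappa ->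
  heat_equation kappa n (bessel_heat kappa).
Proof.
  intros Hk r t [Hr _] Ht.
  assert (D1 := fun x => is_derive_heat_r kappa t x Hk Ht).
  assert (D2 := is_derive_heat_rr kappa t r Hk Ht).
  assert (D3 := is_derive_heat_t kappa r t Hk Ht).
  assert (E1 : forall x, Derive (fun x => bessel_heat kappa x t) x = Series (heat_term_r kappa t x))
    by (intros x; apply is_derive_unique, D1).
  assert (D2' : is_derive (Derive (fun x => bessel_heat kappa x t)) r (Series (heat_term_rr kappa t r)))
    by (apply is_derive_ext with (2 := D2); intros; symmetry; apply E1).
  split; [split; [eexists; apply D1 | simpl; eexists; exact D2']|].
  split; [eexists; exact D3|].
  change (kappa * (Derive (Derive (fun x => bessel_heat kappa x t)) r
    + 1 / r * Derive (fun x => bessel_heat kappa x t) r)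
    = Derive (fun s => bessel_heat kappa r s) t).
  refine (eq_trans _ (eq_sym (is_derive_unique _ _ _ D3))); rewrite E1.
  rewrite (is_derive_unique _ _ _ D2').
  assert (HM := ex_series_decay2 kappa t Hk Ht).
  assert (X1 := ex_series_dom _ _ (heat_term_r_bound kappa t r) HM).
  assert (X2 := ex_series_dom _ _ (heat_term_rr_bound kappa t r) HM).
  rewrite <- Series_scal_l, <- Series_plus, <- Series_scal_l.
  - apply Series_ext; intros k; unfold heat_term, heat_term_r, heat_term_rr, decay.
    rewrite J0_integral; assert (P := INR_S_pos k).
    assert (B := bessel_equation (INR (S k) * r)).
    set (c := INR (S k)) in *; set (e := exp (- c ^ 2 * kappa * t)).
    (* Multiplying by [r] clears [1 / r] and exposes Bessel's equation at [z = c * r], with common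
       factor [kappa * c * e]. *)
    apply Rmult_eq_reg_l with r; [|lra].
    transitivity (kappa * c * e * (c * r * bessel_integral2 (c * r) + bessel_integral1 (c * r)));
      [field; lra|].
    replace (c * r * bessel_integral2 (c * r) + bessel_integral1 (c * r))
      with (- (c * r * bessel_integral (c * r))) by lra.
    ring.
  - exact X2.
  - destruct X1 as [l Hl]; eexists; apply is_series_Rscal, Hl.
Qed.

Lemma bessel_heat_axis (kappa t : R) : bessel_heat kappa 0 t = theta_tail (kappa * t).
Proof.
  apply Series_ext; intros k; unfold heat_term.
  rewrite Rmult_0_r, J0_0, Rmult_1_l; f_equal; ring.
Qed.

Lemma bessel_heat_axis_condition (kappa : R) : 0 < kappa ->
  axis_condition kappa (bessel_heat kappa).
Proof.
  intros Hk t Ht; rewrite !bessel_heat_axis.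
  replace (kappa * (PI ^ 2 / (kappa ^ 2 * t))) with (PI ^ 2 / (kappa * t)) by (field; lra).
  assert (H := theta_functional_equation (kappa * t) ltac:(nra)); lra.
Qed.

Lemma heat_term_0 (kappa r : R) (k : nat) : heat_term kappa r 0 k = J0 (INR (S k) * r).
Proof. unfold heat_term; now rewrite Rmult_0_r, exp_0, Rmult_1_r. Qed.

Lemma is_series_heat_term_0 (kappa r : R) (n : nat) : annulus n r ->
  is_series (heat_term kappa r 0)
    (- (1 / 2) + 1 / r
     + 2 * sum_n_m (fun m => 1 / sqrt (r ^ 2 - 4 * INR m ^ 2 * PI ^ 2)) 1 n).
Proof.
  intros Hr; apply is_series_ext with (2 := schlomilch_series n r Hr).
  intros k; symmetry; apply heat_term_0.
Qed.

(** The series at time 0 offers no summable majorant, but the factors [exp (- k^2 kappa t)] decrease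
    in [k], lie in [[0, 1]] and tend to 1, as [abel_limit] requires. *)
Lemma bessel_heat_initial_limit (kappa r : R) (n : nat) : 0 < kappa -> annulus n r ->
  filterlim (fun t => bessel_heat kappa r t) (at_right 0) (locally (bessel_heat kappa r 0)).
Proof.
  intros Hk Hr.
  assert (X : ex_series (fun k => J0 (INR (S k) * r)))
    by (eexists; exact (schlomilch_series n r Hr)).
  replace (bessel_heat kappa r 0) with (Series (fun k => J0 (INR (S k) * r)))
    by (apply Series_ext; intros k; symmetry; apply heat_term_0).
  apply (abel_limit (at_right 0) (fun k => J0 (INR (S k) * r))
    (fun k t => exp (- INR (S k) ^ 2 * kappa * t)) X).
  - exists (mkposreal 1 Rlt_0_1); intros t _ Ht; split; [|split].
    + intros k; left; apply exp_increasing.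
      rewrite (S_INR (S k)); assert (P := INR_S_pos k).
      assert (0 < kappa * t) by nra; nra.
    + intros k; split; [left; apply exp_pos|].
      rewrite <- exp_0; left; apply exp_increasing.
      assert (P := INR_S_pos k); assert (0 < kappa * t) by nra.
      assert (0 < INR (S k) ^ 2) by nra; nra.
    + exact (ex_series_heat_term kappa t r Hk Ht).
  - intros k; set (c := - INR (S k) ^ 2 * kappa).
    assert (C : continuous (fun t => exp (c * t)) 0)
      by (apply (ex_derive_continuous (fun t => exp (c * t))); auto_derive; trivial).
    unfold continuous in C; rewrite Rmult_0_r, exp_0 in C.
    apply filterlim_filter_le_1 with (2 := C); apply filter_le_within.
Qed.

Theorem mainTheorem4 (kappa : R) (n : nat) (hkappa : 0 < kappa) (hn : (1 <= n)%nat) :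
  (forall r t : R, 0 <= r <= radius n -> 0 < t -> ex_series (heat_term kappa r t)) /\
  (forall r : R, annulus n r -> ex_series (heat_term kappa r 0)) /\
  solves_heat_problem kappa n (bessel_heat kappa).
Proof.
  split; [intros r t _ Ht; now apply ex_series_heat_term|].
  split; [intros r Hr; eexists; exact (is_series_heat_term_0 kappa r n Hr)|].
  split; [now apply bessel_heat_equation|].
  split; [now apply bessel_heat_axis_condition|].
  split; [intros r Hr; exact (is_series_unique _ _ (is_series_heat_term_0 kappa r n Hr))|].
  split; [|intros r Hr; now apply bessel_heat_initial_limit with n].
  intros t Ht.
  (* The value on the axis is attained because the sum is differentiable, hence continuous, in [r]
     at 0. *)
  apply filterlim_filter_le_1 with
    (2 := is_derive_continuous _ _ _ (is_derive_heat_r kappa t 0 hkappa Ht)).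
  apply filter_le_within.
Qed.
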